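(* Let $I=(-1,1)$ and let $*_{\mathtt D}$ be the convolution on $L^2_{\mathbb{C}}(I)$ associated to the Hilbert basis $e_k(x)=\sin(\frac{k\pi}2(x+1))$, $k\in\mathbb{N}^*$, i.e. $C*_{\mathtt D}u=\sum_{k\in\mathbb{N}^*}\langle e_k|C\rangle\langle e_k|u\rangle e_k$. Let $P$ be the orthogonal projection of $L^2_{\mathbb{C}}(I)$ onto the closure of $\mathrm{Span}(\{e_{4l+1}:l\in\mathbb{N}\})$. Let $C\in L^2_{\mathbb{C}}(I)$ be even, and let $\hat C_{\mathtt a}$ and $\widehat{PC}_{\mathtt a}$ denote the extensions of $C$ and $PC$, respectively, to $2$-antiperiodic functions on $\mathbb{R}$. Then for every $u\in L^2_{\mathbb{C}}(I)$ and $x\in I$ $$(C*_{\mathtt D}u)(x)=\frac12\int_{-1}^1\widehat{PC}_{\mathtt a}(x-y)u(y)\,dy+\frac12\int_{-1}^1\widehat{PC}_{\mathtt a}(-x-y)u(y)\,dy-\frac12\int_{-1}^1(\hat C_{\mathtt a}-\widehat{PC}_{\mathtt a})(x-y)u(y)\,dy-\frac12\int_{-1}^1(\hat C_{\mathtt a}-\widehat{PC}_{\mathtt a})(-x-y)u(y)\,dy .$$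
   Context: $\mathbb{N}=\{0,1,2,\dots\}$, $\mathbb{N}^*=\{1,2,\dots\}$. $\langle g|h\rangle=\int_{-1}^1g^*(y)h(y)\,dy$ with $^*$ complex conjugation. A function $F$ on $\mathbb{R}$ is $2$-antiperiodic if $F(x+2)=-F(x)$. The value $(C*_{\mathtt D}u)(x)$ is the sum of the (absolutely convergent) series $\sum_{k\in\mathbb{N}^*}\langle e_k|C\rangle\langle e_k|u\rangle e_k(x)$. The $e_k$ are the normalized eigenfunctions of $-\frac4{\pi^2}\frac{d^2}{dx^2}$ on $I$ with Dirichlet boundary conditions. *)

(* Defs.v *)
From HB Require Import structures.
From mathcomp Require Import all_boot all_order all_algebra.
From mathcomp Require Import all_classical all_reals all_analysis.
From mathcomp Require Import complex.

Set Implicit Arguments.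
Unset Strict Implicit.
Unset Printing Implicit Defensive.

Import Order.TTheory GRing.Theory Num.Theory.
Import numFieldNormedType.Exports.

Local Open Scope classical_set_scope.
Local Open Scope ring_scope.
Local Open Scope complex_scope.

(** Elements of [L^2_C(I)] are represented by functions [R -> R[i]], of which
    only the values on [I = itvI] matter, up to equality almost everywhere on
    [I].  Measurability refers to the Borel sets, hence every class has such a
    representative. *)

Definition itvI {R : realType} : set R := `]-1, 1[.

Definition cintegral {R : realType} (f : R -> R[i]) : R[i] :=
  (\int[lebesgue_measure]_(y in itvI) complex.Re (f y))
    +i* (\int[lebesgue_measure]_(y in itvI) complex.Im (f y)).

Definition L2C {R : realType} (f : R -> R[i]) : Prop :=
  [/\ measurable_fun itvI (fun y => complex.Re (f y)),
      measurable_fun itvI (fun y => complex.Im (f y)) &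
      (\int[lebesgue_measure]_(y in itvI)
          ((ComplexField.Normc.normc (f y)) ^+ 2)%:E < +oo)%E].

Definition inner {R : realType} (g h : R -> R[i]) : R[i] :=
  cintegral (fun y => (g y)^* * h y).

Definition L2norm {R : realType} (f : R -> R[i]) : R :=
  Num.sqrt (complex.Re (inner f f)).

Definition lspan {R : realType} (S : set (R -> R[i])) : set (R -> R[i]) :=
  [set v | exists n (a : 'I_n -> R[i]) (g : 'I_n -> R -> R[i]),
     (forall i, S (g i)) /\ v = (fun x => \sum_(i < n) a i * g i x)].

Definition L2closure {R : realType} (V : set (R -> R[i])) : set (R -> R[i]) :=
  [set f | L2C f /\
     forall eps : R, 0 < eps -> exists2 v, V v & L2norm (fun x => f x - v x) < eps].

(** [g] represents the orthogonal projection of the class of [f] onto the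
    closed subspace [W]. *)
Definition orth_proj {R : realType} (W : set (R -> R[i])) (f g : R -> R[i]) :
    Prop :=
  W g /\ forall h, W h -> inner h (fun x => f x - g x) = 0.

(** Only the [eD k] with [k >= 1] form the Hilbert basis. *)
Definition eD {R : realType} (k : nat) (x : R) : R[i] :=
  (sin (k%:R * pi / 2 * (x + 1)))%:C.

(** The regular module [R[i]^o] carries the usual topology of the complex
    numbers. *)
Definition convD_term {R : realType} (C u : R -> R[i]) (x : R) :
    nat -> R[i]^o :=
  fun n => inner (eD n.+1) C * inner (eD n.+1) u * eD n.+1 x.

Definition convD {R : realType} (C u : R -> R[i]) (x : R) : R[i] :=
  limn (series (convD_term C u x)).

(** Evenness of the class of [f] in [L^2_C(I)]. *)
Definition even_on_I {R : realType} (f : R -> R[i]) : Prop :=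
  {ae lebesgue_measure, forall x : R, itvI x -> f (- x) = f x}.

(** The values of [F] at the odd integers are not determined by [f], beyond
    antiperiodicity; they form a null set. *)
Definition antiperiodic_ext {R : realType} (f F : R -> R[i]) : Prop :=
  (forall x, F (x + 2) = - F x) /\ (forall x, itvI x -> F x = f x).

(* Main.v *)
Require Import Defs.
From HB Require Import structures.
From mathcomp Require Import all_boot all_order all_algebra.
From mathcomp Require Import all_classical all_reals all_analysis.
From mathcomp Require Import complex.
From mathcomp Require Import measurable_realfun ring lra zify.
Import Order.TTheory GRing.Theory Num.Theory.
Import numFieldNormedType.Exports.
Local Open Scope classical_set_scope.
Local Open Scope ring_scope.
Local Open Scope complex_scope.

(** Put [B(F, u)(x) = 1/2 int F(x - y) u(y) dy + 1/2 int F(- x - y) u(y) dy], the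
    integrals being over [I]; the right-hand side is [2 B(PCa, u) - B(Ca, u)].
    For odd [k], [e_k(x - y) + e_k(- x - y) = 2 s_k e_k(x) e_k(y)] with
    [s_k = sin (k pi / 2)], hence [B(e_k, u)(x) = s_k <e_k|u> e_k(x)].  Since [B]
    is continuous for the [L^2] norm, Bessel's inequality yields
    [B(F, u)(x) = \sum_k s_k <e_k|F> <e_k|u> e_k(x)] for every antiperiodic [F]
    whose restriction to [I] lies in the closed span of the [e_k] with [k] odd.
    The coefficient [p_k] of [PC] is that of [C], [c_k], for [k = 1 mod 4] and is
    zero otherwise, so that [2 s_k p_k - s_k c_k = c_k] for odd [k]; for even [k]
    both [s_k] and, by evenness of [C], [c_k] vanish.

    That even functions belong to this closed span is shown without
    Riesz-Fischer: the span of the odd sines is stable under multiplication by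
    [e_1^2], so it contains [e_1 (1 - (a e_1^2)^n)^(m^n)]; for suitable [a] and
    [m] these functions converge boundedly to [e_1] times the indicator of
    [b < |y|].  A pi-lambda argument replaces this set by any Borel set of
    values of [|y|], and simple functions approximate [f / e_1]. *)

(** * Square-integrable real functions on I *)

Section RealL2.
Set Implicit Arguments.
Unset Strict Implicit.
Context {R : realType}.
Implicit Types (f g h : R -> R).
Local Notation mu := (@lebesgue_measure R).
Local Notation I := (@itvI R).

Lemma ae_sub (P Q : R -> Prop) : (forall x, P x -> Q x) ->
  {ae mu, forall x, P x} -> {ae mu, forall x, Q x}.
Proof.
by move=> PQ; apply: filterS; first exact: (ae_filter_ringOfSetsType mu).
Qed.

Definition L2real f := measurable_fun I f /\
  (\int[mu]_(x in I) ((f x) ^+ 2)%:E < +oo)%E.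

Definition ip f g : R := \int[mu]_(x in I) (f x * g x).

Lemma measurable_itvI : measurable (I : set (measurableTypeR R)).
Proof. exact: measurable_itv. Qed.
Hint Resolve measurable_itvI : core.

Lemma lebesgue_itvI : mu I = 2%:E.
Proof.
rewrite /itvI lebesgue_measure_itv/= lte_fin ifT; last lra.
by rewrite -EFinB; congr EFin; lra.
Qed.

Lemma measurable_sqr f : measurable_fun I f ->
  measurable_fun I (EFin \o (fun x => (f x) ^+ 2)).
Proof. by move=> mf; apply/measurable_EFinP; exact: measurable_funX. Qed.

Lemma L2real_sqr f : L2real f -> mu.-integrable I (EFin \o (fun x => (f x) ^+ 2)).
Proof.
case=> mf lf; apply/integrableP; split; first exact: measurable_sqr.
rewrite (le_lt_trans _ lf)// ge0_le_integral//.
- by apply: measurableT_comp => //; exact: measurable_sqr.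
- exact: measurable_sqr.
- by move=> x Ix /=; rewrite lee_fin ger0_norm// sqr_ge0.
Qed.

Lemma L2real_le_integrable f (F : R -> R) : measurable_fun I f ->
  mu.-integrable I (EFin \o F) -> (forall x, I x -> f x ^+ 2 <= F x) -> L2real f.
Proof.
move=> mf iF fF; split=> //.
have /integrableP[_ lF] := iF; rewrite (le_lt_trans _ lF)// ge0_le_integral//.
- by move=> x _; rewrite lee_fin sqr_ge0.
- exact: measurable_sqr.
- by apply: measurableT_comp => //; exact: measurable_int iF.
- by move=> x Ix /=; rewrite lee_fin (le_trans (fF _ Ix))// ler_norm.
Qed.

(** The product is dominated by [f^2 + g^2], because [(f + g)^2] and [(f - g)^2] are nonnegative. *)
Lemma L2real_mul f g : L2real f -> L2real g ->
  mu.-integrable I (EFin \o (fun x => f x * g x)).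
Proof.
move=> Lf Lg.
have iS := integrableD measurable_itvI (L2real_sqr Lf) (L2real_sqr Lg).
apply: (le_integrable measurable_itvI _ _ iS).
  by apply/measurable_EFinP; apply: measurable_funM; [case: Lf | case: Lg].
move=> x _ /=; rewrite lee_fin [leRHS]ger0_norm ?addr_ge0 ?sqr_ge0// ler_norml.
have := sqr_ge0 (f x + g x); have := sqr_ge0 (f x - g x).
have := sqr_ge0 (f x); have := sqr_ge0 (g x); rewrite !expr2 => *.
by apply/andP; split; nra.
Qed.

Lemma L2realD f g : L2real f -> L2real g -> L2real (fun x => f x + g x).
Proof.
move=> Lf Lg.
have iS := integrableD measurable_itvI (L2real_sqr Lf) (L2real_sqr Lg).
have i2 := integrableZl measurable_itvI 2 iS.
apply: (@L2real_le_integrable _ (fun x => 2 * (f x ^+ 2 + g x ^+ 2))).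
- by apply: measurable_funD; [case: Lf | case: Lg].
- exact: i2.
- by move=> x _; have := sqr_ge0 (f x - g x); rewrite !expr2; nra.
Qed.

Lemma L2realZ (a : R) f : L2real f -> L2real (fun x => a * f x).
Proof.
move=> Lf; have i2 := integrableZl measurable_itvI (a ^+ 2) (L2real_sqr Lf).
apply: (@L2real_le_integrable _ (fun x => a ^+ 2 * (f x ^+ 2))).
- by apply: measurable_funM => //; case: Lf.
- exact: i2.
- by move=> x _; rewrite exprMn.
Qed.

Lemma L2real_bounded f (M : R) : measurable_fun I f ->
  (forall x, I x -> `|f x| <= M) -> L2real f.
Proof.
move=> mf fM; apply: (@L2real_le_integrable _ (cst (M ^+ 2))) => //.
  apply/integrableP; split; first by apply/measurable_EFinP.
  by rewrite /= integral_cst// [X in (_ * X)%E](_ : _ = (2%R)%:E)?ltry//; exact: lebesgue_itvI.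
by move=> x Ix /=; rewrite -real_normK ?num_real// ler_sqr ?nnegrE//
  ?fM// (le_trans _ (fM _ Ix)).
Qed.

Lemma L2real0 : L2real (fun=> 0).
Proof. by apply: (@L2real_bounded _ 0) => // x _; rewrite normr0. Qed.

Lemma L2realN f : L2real f -> L2real (fun x => - f x).
Proof.
by move=> Lf; under eq_fun do rewrite -mulN1r; exact: L2realZ.
Qed.

Lemma L2realB f g : L2real f -> L2real g -> L2real (fun x => f x - g x).
Proof. by move=> Lf Lg; apply: L2realD => //; exact: L2realN. Qed.

Lemma L2real_sum n (F : nat -> R -> R) : (forall k, (k < n)%N -> L2real (F k)) ->
  L2real (fun x => \sum_(k < n) F k x).
Proof.
elim: n => [|n IH] LF.
  by under eq_fun do rewrite big_ord0; exact: L2real0.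
under eq_fun do rewrite big_ord_recr/=.
by apply: L2realD; [apply: IH => k kn; apply: LF; exact: ltnW | exact: LF].
Qed.

Lemma ipC f g : ip f g = ip g f.
Proof. by apply: eq_Rintegral => x _; rewrite mulrC. Qed.

Lemma ipDl f g h : L2real f -> L2real g -> L2real h ->
  ip (fun x => f x + g x) h = ip f h + ip g h.
Proof.
move=> Lf Lg Lh; rewrite /ip -RintegralD//; try exact: L2real_mul.
by apply: eq_Rintegral => x _; rewrite mulrDl.
Qed.

Lemma ipZl (a : R) f h : L2real f -> L2real h ->
  ip (fun x => a * f x) h = a * ip f h.
Proof.
move=> Lf Lh; rewrite /ip -RintegralZl//; try exact: L2real_mul.
by apply: eq_Rintegral => x _; rewrite mulrA.
Qed.

Lemma ipNl f h : L2real f -> L2real h -> ip (fun x => - f x) h = - ip f h.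
Proof.
move=> Lf Lh; rewrite -mulN1r -ipZl//; congr ip.
by apply/funext => x; rewrite mulN1r.
Qed.

Lemma ipBl f g h : L2real f -> L2real g -> L2real h ->
  ip (fun x => f x - g x) h = ip f h - ip g h.
Proof. by move=> *; rewrite ipDl ?ipNl//; exact: L2realN. Qed.

Lemma ip0l h : ip (fun=> 0) h = 0.
Proof.
have -> : ip (fun=> 0) h = ip (fun x => 0 * (fun=> 0) x) (fun=> 0).
  by apply: eq_Rintegral => x _; rewrite !mul0r.
by rewrite ipZl ?mul0r//; exact: L2real0.
Qed.

Lemma ip_suml n (F : nat -> R -> R) h : (forall k, (k < n)%N -> L2real (F k)) ->
  L2real h -> ip (fun x => \sum_(k < n) F k x) h = \sum_(k < n) ip (F k) h.
Proof.
move=> LF Lh; elim: n LF => [|n IH] LF.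
  by under eq_fun do rewrite big_ord0; rewrite ip0l big_ord0.
under eq_fun do rewrite big_ord_recr/=.
have LF' k : (k < n)%N -> L2real (F k) by move=> kn; apply: LF; exact: ltnW.
rewrite ipDl ?IH ?big_ord_recr//; [exact: L2real_sum | exact: LF].
Qed.

Lemma ip_ge0 f : 0 <= ip f f.
Proof. by apply: Rintegral_ge0 => x _; rewrite -expr2 sqr_ge0. Qed.

Lemma ip_sub f g : L2real f -> L2real g ->
  ip (fun x => f x - g x) (fun x => f x - g x) = ip f f - 2 * ip f g + ip g g.
Proof.
move=> Lf Lg; have LB := L2realB Lf Lg.
rewrite ipBl// ipC [ip g _]ipC !ipBl// (ipC g f).
by ring.
Qed.

Lemma ip_add f g : L2real f -> L2real g ->
  ip (fun x => f x + g x) (fun x => f x + g x) = ip f f + 2 * ip f g + ip g g.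
Proof.
move=> Lf Lg; have LB := L2realD Lf Lg.
rewrite ipDl// ipC [ip g _]ipC !ipDl// (ipC g f).
by ring.
Qed.

Lemma ip_add_le f g : L2real f -> L2real g ->
  ip (fun x => f x + g x) (fun x => f x + g x) <= 2 * (ip f f + ip g g).
Proof.
move=> Lf Lg; have := ip_ge0 (fun x => f x - g x).
by rewrite ip_sub// ip_add//; lra.
Qed.

Lemma ip_triangle f g h : L2real f -> L2real g -> L2real h ->
  ip (fun x => f x - h x) (fun x => f x - h x) <=
  2 * (ip (fun x => f x - g x) (fun x => f x - g x) +
       ip (fun x => g x - h x) (fun x => g x - h x)).
Proof.
move=> Lf Lg Lh.
have -> : (fun x => f x - h x) = (fun x => (f x - g x) + (g x - h x)).
  by apply/funext => x; rewrite addrA subrK.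
by apply: ip_add_le; exact: L2realB.
Qed.

(** Takes the place of Cauchy-Schwarz: expand the nonnegative squared norms of [f - d^-1 g] and
    [f + d^-1 g] and multiply by [d]. The free weight [d] later makes the term of a fixed function
    small first and that of an approximation error afterwards. *)
Lemma ip_amgm (d : R) f g : 0 < d -> L2real f -> L2real g ->
  `|ip f g| <= d * ip f f + d^-1 * ip g g.
Proof.
move=> d0 Lf Lg.
have Lg' := L2realZ d^-1 Lg.
have h1 := ip_ge0 (fun x => f x - d^-1 * g x).
have h2 := ip_ge0 (fun x => f x + d^-1 * g x).
have di : 0 < d^-1 by rewrite invr_gt0.
have e : ip (fun x => d^-1 * g x) (fun x => d^-1 * g x) = d^-1 * d^-1 * ip g g.
  by rewrite ipZl// ipC ipZl// mulrA.
rewrite ip_sub// in h1; rewrite ip_add// in h2.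
have e2 : ip f (fun x => d^-1 * g x) = d^-1 * ip f g by rewrite ipC ipZl// ipC.
rewrite e e2 in h1 h2.
have H (t : R) : 0 <= ip f f + 2 * (d^-1 * t) + d^-1 * d^-1 * ip g g ->
    - t <= d * ip f f + d^-1 * ip g g.
  move=> /(mulr_ge0 (ltW d0)); have := ip_ge0 f; have := ip_ge0 g.
  have -> : d * (ip f f + 2 * (d^-1 * t) + d^-1 * d^-1 * ip g g) =
      d * ip f f + 2 * t + d^-1 * ip g g by field; rewrite gt_eqF.
  move=> g0 f0; have := mulr_ge0 (ltW d0) f0; have := mulr_ge0 (ltW di) g0.
  by lra.
rewrite ler_norml; apply/andP; split; first by rewrite lerNl; exact: H.
by rewrite -[leLHS]opprK; apply: H; lra.
Qed.

Lemma ip_aez f g : L2real f -> {ae mu, forall x, I x -> f x = g x} ->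
  measurable_fun I g -> L2real g /\ ip (fun x => f x - g x) (fun x => f x - g x) = 0.
Proof.
move=> [mf lf] fg mg; have e : {ae mu, forall x, I x -> (f x ^+ 2)%:E = (g x ^+ 2)%:E}.
  by apply: ae_sub fg => x + Ix => ->.
have mf2 := measurable_sqr mf; have mg2 := measurable_sqr mg.
split.
  split=> //; suff <- : (\int[mu]_(x in I) (f x ^+ 2)%:E =
    \int[mu]_(x in I) (g x ^+ 2)%:E)%E by [].
  exact: (ae_eq_integral _ _ measurable_itvI mf2 mg2 e).
have mB : measurable_fun I (EFin \o (fun x => (f x - g x) * (f x - g x))).
  by apply/measurable_EFinP; apply: measurable_funM; exact: measurable_funB.
have e0 : ae_eq mu I (EFin \o (fun x => (f x - g x) * (f x - g x))) (cst 0%E).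
  by apply: ae_sub fg => x + Ix => /(_ Ix) /= ->; rewrite subrr mulr0.
rewrite /ip /Rintegral (ae_eq_integral _ _ measurable_itvI mB _ e0)//.
by rewrite integral0.
Qed.

Lemma eq_L2real f g : (forall x, I x -> f x = g x) -> L2real f -> L2real g.
Proof.
move=> fg Lf; have mg : measurable_fun I g.
  by apply: (eq_measurable_fun _ _ (proj1 Lf)) => x; rewrite inE => /fg.
by apply: (proj1 (ip_aez Lf _ mg)); exact: aeW.
Qed.
End RealL2.

(** * Reflections of antiperiodic functions *)

Section Antiperiodic.
Context {R : realType}.
Set Implicit Arguments.
Unset Strict Implicit.
Local Notation mu := (@lebesgue_measure R).
Local Notation I := (@itvI R).

(** By uniqueness of Lebesgue measure it suffices to test half-open intervals. Reflection moves the
    closed end to the other side, which leaves the length unchanged. *)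
Lemma lebesgue_measure_reflect (z : R) (A : set R) : measurable A ->
  pushforward mu (fun y : R => (z - y : measurableTypeR R)) A = mu A.
Proof.
move=> mA.
have mz : measurable_fun [set: measurableTypeR R] (fun y : R => (z - y : measurableTypeR R)).
  by apply: measurable_funB.
apply/esym/lebesgue_measure_unique => //= _ [[a b]] _ <-.
rewrite /pushforward.
have -> : (fun y : R => z - y) @^-1` `]a, b]%classic = `[z - b, z - a[%classic.
  by apply/seteqP; split => y /=; rewrite !in_itv/= => /andP[? ?]; apply/andP; split; lra.
rewrite !lebesgue_measure_itv/= !lte_fin.
have -> : (z - b < z - a) = (a < b) by apply/idP/idP => ?; lra.
by case: ifP => // _; rewrite -!EFinB; congr EFin; ring.
Qed.

Lemma ge0_integral_reflect (z : R) (h : R -> \bar R) :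
  measurable_fun [set: R] h -> (forall r, 0 <= h r)%E ->
  (\int[mu]_y h (z - y)%R = \int[mu]_y h y)%E.
Proof.
move=> mh h0.
have mz : measurable_fun [set: measurableTypeR R] (fun y : R => (z - y : measurableTypeR R)).
  by apply: measurable_funB.
have := @ge0_integral_pushforward _ _ (measurableTypeR R) (measurableTypeR R) R _ mz mu setT h
  measurableT mh (fun y _ => h0 y).
rewrite preimage_setT => <-.
by apply: eq_measure_integral => //= A mA _; exact: lebesgue_measure_reflect.
Qed.

(** A translation is the composite of two reflections: [y + z = z - (0 - y)]. *)
Lemma ge0_integral_shift (z : R) (h : R -> \bar R) :
  measurable_fun [set: R] h -> (forall r, 0 <= h r)%E ->
  (\int[mu]_y h (y + z)%R = \int[mu]_y h y)%E.
Proof.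
move=> mh h0; rewrite -(ge0_integral_reflect z mh h0).
rewrite -(@ge0_integral_reflect 0 (fun y => h (z - y)%R))//.
  by apply: eq_integral => y _; congr h; ring.
apply: measurableT_comp => //; exact: measurable_funB.
Qed.

Variable F : R -> R.
Hypothesis FA : forall x, F (x + 2) = - F x.
Hypothesis LF : L2real F.

(** For [y] and [z] in [I] the point [z - y] lies in [(-2, 2)]. There antiperiodicity writes [F] as
    its restriction to [I], minus the translates of that restriction by 2 and -2, plus the two
    values at 1 and -1. The supports are disjoint, so squares add, and each of the three main pieces
    has squared norm [ip F F] over the line. Measurability of [F] outside [I] follows from the same
    decomposition. *)
Lemma antiperiodic_reflect (z : R) : I z -> L2real (fun y => F (z - y)) /\
  ip (fun y => F (z - y)) (fun y => F (z - y)) <= 3 * ip F F.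
Proof.
move=> Iz.
pose FI := F \_ I.
have mFI : measurable_fun [set: R] FI.
  by apply/(measurable_restrictT _ _).1 => //; [exact: measurable_itvI | case: LF].
have Iin (t : R) : (t \in I) = (-1 < t < 1) by rewrite mem_setE/= in_itv.
have FIt (t : R) : FI t = if -1 < t < 1 then F t else 0 by rewrite /FI patchE Iin.
(* The values of [F] at 1 and -1 are not controlled by the restriction to [I]. These one-point terms
   make the decomposition exact everywhere and have integral zero. *)
pose P (a t : R) := if t == a then F a else 0.
have mP a : measurable_fun [set: R] (P a).
  apply: measurable_fun_ifT => //; exact: measurable_fun_eqr.
pose h t := FI t - FI (t + (-2)) - FI (t + 2) + P 1 t + P (-1) t.
pose H t := FI t ^+ 2 + FI (t + (-2)) ^+ 2 + FI (t + 2) ^+ 2 + P 1 t ^+ 2 + P (-1) t ^+ 2.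
have mS a : measurable_fun [set: R] (fun t => FI (t + a)).
  by apply: measurableT_comp => //; exact: measurable_funD.
have mh : measurable_fun [set: R] h.
  by do 2 (apply: measurable_funD => //); do 2 apply: measurable_funB => //.
have key (y : R) : I y -> F (z - y) = h (z - y) /\ F (z - y) ^+ 2 = H (z - y).
  move=> Iy; move: Iz Iy; rewrite /itvI/= !in_itv/= => /andP[z1 z2] /andP[y1 y2].
  set t := z - y; have t1 : -2 < t by rewrite /t; lra.
  have t2 : t < 2 by rewrite /t; lra.
  have c1 : FI t = if -1 < t < 1 then F t else 0 by [].
  have c2 : FI (t + (-2)) = if 1 < t then - F t else 0.
    rewrite FIt; have -> : (-1 < t + -2 < 1) = (1 < t).
      by apply/idP/idP => [/andP[] *|*]; last (apply/andP; split); lra.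
    by case: ifP => // _; rewrite -[in RHS](subrK 2 t) FA opprK.
  have c3 : FI (t + 2) = if t < -1 then - F t else 0.
    rewrite FIt; have -> : (-1 < t + 2 < 1) = (t < -1).
      by apply/idP/idP => [/andP[] *|*]; last (apply/andP; split); lra.
    by rewrite FA.
  rewrite /h /H /P c1 c2 c3.
  case: (ltrgtP t 1) => [ta|ta|->]; case: (ltrgtP t (-1)) => [tb|tb|tb];
    rewrite ?tb /=; try (exfalso; lra); try (split; ring).
  1-3: have n1 : ((1 : R) == -1) = false by apply/negbTE; rewrite gt_eqF//; lra.
  1-3: have n2 : ((1 : R) < -1) = false by apply/negbTE; rewrite -leNgt; lra.
  1-3: by rewrite ?n1 ?n2 ?andbF; split; ring.
have P0 a : (\int[mu]_t (P a t ^+ 2)%:E = 0)%E.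
  rewrite (_ : (fun t => (P a t ^+ 2)%:E) = (cst (F a ^+ 2)%:E) \_ [set a]).
    by rewrite -integral_mkcond integral_set1.
  apply/funext => t; rewrite /P patchE; case: ifPn => [/eqP ->|ta].
    by rewrite mem_set.
  by rewrite memNset ?expr0n//= => /eqP; apply/negP.
have msq (g : R -> R) : measurable_fun [set: R] g ->
    measurable_fun [set: R] (fun t => (g t ^+ 2)%:E : \bar R).
  by move=> mg; apply/measurable_EFinP; exact: measurable_funX.
have N0 : (\int[mu]_t (FI t ^+ 2)%:E = \int[mu]_(t in I) (F t ^+ 2)%:E)%E.
  rewrite [RHS]integral_mkcond; apply: eq_integral => t _.
  by rewrite /FI !patchE; case: ifP => //; rewrite expr0n.
have NS a : (\int[mu]_t (FI (t + a) ^+ 2)%:E = \int[mu]_(t in I) (F t ^+ 2)%:E)%E.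
  rewrite -N0 -(@ge0_integral_shift a (fun t => (FI t ^+ 2)%:E))//; first exact: msq.
  by move=> r; rewrite lee_fin sqr_ge0.
set N := (\int[mu]_(t in I) (F t ^+ 2)%:E)%E in N0 NS.
have g0 (g : R -> R) t : (0 <= (g t ^+ 2)%:E)%E by rewrite lee_fin sqr_ge0.
have NH : (\int[mu]_t (H t)%:E = N + N + N)%E.
{ rewrite /H; under eq_integral do rewrite !EFinD.
  have mD (g1 g2 : R -> \bar R) : measurable_fun [set: R] g1 -> measurable_fun [set: R] g2 ->
    measurable_fun [set: R] (fun t => g1 t + g2 t)%E by exact: emeasurable_funD.
  rewrite !ge0_integralD//=;
    try exact: (mD _ _ (msq _ mFI) (msq _ (mS (-2)))); try by move=> t _; rewrite ?adde_ge0// ?g0.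
  all: try exact: msq.
  all: have m3 := mD _ _ (mD _ _ (msq _ mFI) (msq _ (mS (-2)))) (msq _ (mS 2)).
  all: try exact: m3.
  all: try exact: (mD _ _ m3 (msq _ (mP 1))).
  by rewrite N0 !NS !P0 !adde0. }
have mH : measurable_fun [set: R] (fun t => (H t)%:E : \bar R).
  apply/measurable_EFinP; rewrite /H.
  by repeat (apply: measurable_funD); apply: measurable_funX.
have mHz : measurable_fun [set: R] (fun t => (H (z - t))%:E : \bar R).
  by apply: (measurableT_comp mH); exact: measurable_funB.
have H0 t : (0 <= (H t)%:E)%E by rewrite lee_fin /H !addr_ge0 ?sqr_ge0.
have mFz : measurable_fun I (fun y => F (z - y)).
  apply: (@eq_measurable_fun _ _ (measurableTypeR R) (measurableTypeR R) I (fun y => h (z - y))).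
    by move=> y; rewrite inE => /key[-> _].
  apply: measurable_funTS; apply: measurableT_comp => //; exact: measurable_funB.
have le3 : (\int[mu]_(y in I) (F (z - y) ^+ 2)%:E <= N + N + N)%E.
  rewrite -NH -(ge0_integral_reflect z mH H0).
  have -> : (\int[mu]_(y in I) (F (z - y) ^+ 2)%:E =
      \int[mu]_(y in I) (H (z - y))%:E)%E.
    by apply: eq_integral => y; rewrite inE => /key[_ ->].
  (* Enlarging the domain from [I] to the whole line is where the constant 3 enters; any finite
     constant suffices for continuity. *)
  apply: ge0_subset_integral => //; first exact: measurable_itvI.
have Ny : (N < +oo)%E by case: LF.
have Nf : N \is a fin_num by rewrite ge0_fin_numE// integral_ge0.
have LFz : L2real (fun y => F (z - y)).
  split; first exact: mFz.
  apply: le_lt_trans le3 _; do 2 (apply: lte_add_pinfty => //).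
split=> //; have -> : 3 * ip F F = fine (N + N + N).
  have -> : ip F F = fine N.
    by rewrite /ip /Rintegral; congr fine; apply: eq_integral => t _; rewrite expr2.
  by rewrite -(fineK Nf) -!EFinD /=; ring.
rewrite /ip /Rintegral; under eq_integral do rewrite -expr2.
apply: fine_le; last exact: le3.
  by rewrite ge0_fin_numE ?integral_ge0//; case: LFz.
by rewrite -(fineK Nf) -!EFinD.
Qed.

End Antiperiodic.

(** * The sine system *)

Section SineSystem.
Context {R : realType}.
Set Implicit Arguments.
Unset Strict Implicit.
Local Notation mu := (@lebesgue_measure R).
Local Notation I := (@itvI R).

Definition sineD (k : nat) (y : R) : R := sin (k%:R * pi / 2 * (y + 1)).

Lemma sin_cos_npi (m : nat) : sin (m%:R * pi) = 0 :> R /\ cos (m%:R * pi) = (-1) ^+ m :> R.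
Proof.
elim: m => [|m [IHs IHc]]; first by rewrite mul0r sin0 cos0 expr0.
rewrite -natr1 mulrDl mul1r sinDpi cosDpi IHs IHc oppr0; split=> //.
by rewrite exprS mulN1r.
Qed.

Lemma continuous_affine (a : R) : continuous (fun y : R => a * (y + 1)).
Proof. by move=> y; apply: cvgM; [exact: cvg_cst | apply: cvgD; [exact: cvg_id | exact: cvg_cst]]. Qed.

Lemma continuous_sineD k : continuous (sineD k).
Proof.
move=> y; apply: (@continuous_comp R R R (fun y => k%:R * pi / 2 * (y + 1)) sin).
  exact: continuous_affine.
exact: continuous_sin.
Qed.

Lemma measurable_sineD (D : set R) k : measurable_fun D (sineD k).
Proof. by apply: measurable_funTS; apply: continuous_measurable_fun; exact: continuous_sineD. Qed.

Lemma sineD_le1 k y : `|sineD k y| <= 1.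
Proof. by rewrite ler_norml sin_geN1 sin_le1. Qed.

Lemma L2real_sineD k : L2real (sineD k).
Proof. by apply: (@L2real_bounded _ _ 1); [exact: measurable_sineD | move=> y _; exact: sineD_le1]. Qed.

Lemma Rintegral_cos (m : nat) :
  \int[mu]_(y in I) cos (m%:R * pi / 2 * (y + 1)) = if m == 0%N then 2 else 0.
Proof.
case: eqP => [->|/eqP m0].
  under eq_Rintegral do rewrite !mul0r cos0.
  have := @Rintegral_cst _ _ _ mu _ measurable_itvI 1; rewrite /cst => ->.
  by rewrite mul1r; exact: (congr1 fine lebesgue_itvI).
pose a : R := m%:R * pi / 2.
have a0 : a != 0 by rewrite /a !mulf_neq0 ?invr_eq0 ?pnatr_eq0// gt_eqF// pi_gt0.
have cc : continuous (fun y : R => cos (a * (y + 1))).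
  move=> y; apply: (@continuous_comp R R R (fun y => a * (y + 1)) cos).
    exact: continuous_affine.
  exact: continuous_cos.
pose G (y : R) := a^-1 * sin (a * (y + 1)).
have dG (y : R) : is_derive y 1 G (cos (a * (y + 1))).
  rewrite /G; apply: is_derive_eq.
  by rewrite ?scaler0 ?add0r ?addr0 ?mulr1 /GRing.scale/=; field.
have cG : continuous G.
  move=> y; apply: differentiable_continuous; apply/derivable1_diffP.
  by have [] := dG y.
have mc : measurable_fun I (fun y : R => cos (a * (y + 1))).
  by apply: measurable_funTS; exact: continuous_measurable_fun.
have ftc : (\int[mu]_(y in `[(-1)%R, 1%R]) (cos (a * (y + 1)))%:E = (G 1)%:E - (G (-1))%:E)%E.
  apply: continuous_FTC2; first lra.
  - exact: continuous_subspaceT.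
  - split.
    + by move=> y _; have [] := dG y.
    + by apply: cvg_at_right_filter; exact: cG.
    + by apply: cvg_at_left_filter; exact: cG.
  - by move=> y _; rewrite derive1E; have [] := dG y.
rewrite -/a /Rintegral /itvI.
(* The endpoints are null, so the integral may be taken over the closed interval, where the
   fundamental theorem of calculus gives [ftc]. *)
rewrite integral_itv_bndo_bndc; last first.
  by apply/measurable_EFinP; exact: mc.
rewrite integral_itv_obnd_cbnd; last first.
  by apply/measurable_EFinP; apply: measurable_funTS; exact: continuous_measurable_fun.
rewrite ftc /G -EFinB /= addNr mulr0 sin0.
have -> : a * (1 + 1) = m%:R * pi by rewrite /a; field.
by rewrite (sin_cos_npi m).1 !mulr0 subrr.
Qed.

(** Product-to-sum formula; the order of the indices makes the truncated subtraction [k - l]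
    exact. *)
Lemma sineDM (k l : nat) (y : R) : (l <= k)%N ->
  sineD k y * sineD l y = 2^-1 * (cos ((k - l)%:R * pi / 2 * (y + 1))
     - cos ((k + l)%:R * pi / 2 * (y + 1))).
Proof.
move=> lk; rewrite /sineD natrB// natrD.
have -> : (k%:R - l%:R) * pi / 2 * (y + 1) = k%:R * pi / 2 * (y + 1) + - (l%:R * pi / 2 * (y + 1)) by ring.
have -> : (k%:R + l%:R) * pi / 2 * (y + 1) = k%:R * pi / 2 * (y + 1) + l%:R * pi / 2 * (y + 1) by ring.
by rewrite !cosD cosN sinN; field.
Qed.

Lemma measurable_cosD (m : nat) : measurable_fun I (fun y : R => cos (m%:R * pi / 2 * (y + 1))).
Proof.
apply: measurable_funTS; apply: continuous_measurable_fun => y.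
apply: (@continuous_comp R R R (fun y => m%:R * pi / 2 * (y + 1)) cos).
  exact: continuous_affine.
exact: continuous_cos.
Qed.

Lemma ip_sineD (k l : nat) : (0 < k)%N -> ip (sineD k) (sineD l) = (k == l)%:R.
Proof.
wlog lk : k l / (l <= k)%N => [hw k0|k0].
  have [lk|kl] := leqP l k; first exact: hw.
  by rewrite ipC eq_sym; apply: hw; [exact: ltnW | exact: ltn_trans k0 kl].
have Lc m : L2real (fun y : R => cos (m%:R * pi / 2 * (y + 1))).
  apply: (@L2real_bounded _ _ 1); first exact: measurable_cosD.
  by move=> y _; exact: cos_max.
have ic m : \int[mu]_(y in I) cos (m%:R * pi / 2 * (y + 1)) =
    ip (fun y => cos (m%:R * pi / 2 * (y + 1))) (fun=> 1).
  by apply: eq_Rintegral => y _; rewrite mulr1.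
have L1 : L2real (fun=> 1 : R).
  by apply: (@L2real_bounded _ _ 1) => // y _; rewrite normr1.
have -> : ip (sineD k) (sineD l) = ip (fun y => 2^-1 * (cos ((k - l)%:R * pi / 2 * (y + 1))
     - cos ((k + l)%:R * pi / 2 * (y + 1)))) (fun=> 1).
  by apply: eq_Rintegral => y _; rewrite mulr1 sineDM.
rewrite ipZl ?ipBl -?ic ?Rintegral_cos//; last exact: L2realB.
have -> : (k + l == 0)%N = false by lia.
have -> : (k - l == 0)%N = (k == l) by lia.
by case: eqP => _; rewrite ?mulr0 ?subr0 ?mulr0// mulVf.
Qed.

(** This is [e_k(0)]: zero for even [k], 1 for [k = 1 mod 4] and -1 for [k = 3 mod 4]. The sign
    change is what the projection [P] has to compensate. *)
Definition sigma (k : nat) : R := sin (k%:R * pi / 2).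

Lemma natr_odd k : odd k -> k%:R = 1 + 2 * k./2%:R :> R.
Proof. by move=> ok; rewrite -[in LHS](odd_double_half k) ok natrD -mul2n natrM. Qed.

Lemma cos_odd_pi2 k : odd k -> cos (k%:R * pi / 2) = 0 :> R.
Proof.
move=> ok; have -> : k%:R * pi / 2 = k./2%:R * pi + pi / 2 :> R.
  by rewrite (natr_odd ok); field.
by rewrite cosDpihalf (sin_cos_npi _).1 oppr0.
Qed.

Lemma sigma_sqr k : odd k -> sigma k ^+ 2 = 1.
Proof.
by move=> /cos_odd_pi2 c0; have := cos2Dsin2 (k%:R * pi / 2 : R); rewrite c0 expr0n add0r.
Qed.

Lemma sigma_half k : odd k -> sigma k = (-1) ^+ k./2.
Proof.
move=> ok; rewrite /sigma; have -> : k%:R * pi / 2 = k./2%:R * pi + pi / 2 :> R.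
  by rewrite (natr_odd ok); field.
by rewrite sinDpihalf (sin_cos_npi _).2.
Qed.

(** Addition formula with [cos (k pi / 2) = 0]. It exhibits the odd-indexed eigenfunctions as even
    functions. *)
Lemma sineD_odd k (y : R) : odd k -> sineD k y = sigma k * cos (k%:R * pi / 2 * y).
Proof.
by move=> ok; rewrite /sineD mulrDr mulr1 sinD cos_odd_pi2// mulr0 add0r mulrC.
Qed.

Lemma sineD_antiperiodic k (y : R) : odd k -> sineD k (y + 2) = - sineD k y.
Proof.
move=> ok; rewrite /sineD.
have -> : k%:R * pi / 2 * (y + 2 + 1) = k%:R * pi / 2 * (y + 1) + k%:R * pi :> R by field.
by rewrite sinD (sin_cos_npi k).1 (sin_cos_npi k).2 mulr0 addr0 -signr_odd ok expr1 mulrN1.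
Qed.

(** Both terms on the left are cosines, of a difference and of a sum, so their sum is twice a
    product of cosines. The two extra factors [sigma k] on the right cancel because
    [sigma k ^+ 2 = 1]. *)
Lemma sineD_reflect k (x y : R) : odd k ->
  sineD k (x - y) + sineD k (- x - y) = 2 * (sigma k * sineD k x * sineD k y).
Proof.
move=> ok; rewrite !sineD_odd//.
have -> : k%:R * pi / 2 * (x - y) = k%:R * pi / 2 * x - k%:R * pi / 2 * y by ring.
have -> : k%:R * pi / 2 * (- x - y) = - (k%:R * pi / 2 * x + k%:R * pi / 2 * y) by ring.
rewrite cosN !cosD cosN sinN; have := sigma_sqr ok; rewrite expr2 => s2.
set c1 := cos _; set c2 := cos (_ * y); set s := sin _; set s' := sin _.
have -> : 2 * (sigma k * (sigma k * c1) * (sigma k * c2)) =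
  2 * (sigma k * sigma k) * (sigma k * (c1 * c2)) by ring.
by rewrite s2; ring.
Qed.
End SineSystem.

(** * Closed spans of sines *)

Section SineClosure.
Context {R : realType}.
Set Implicit Arguments.
Unset Strict Implicit.
Local Notation mu := (@lebesgue_measure R).
Local Notation I := (@itvI R).
Implicit Types (A : pred nat) (f g u v F : R -> R).

Inductive sine_span A : (R -> R) -> Prop :=
| sine_span0 : sine_span A (fun=> 0)
| sine_spanS (c : R) k v : A k -> sine_span A v ->
    sine_span A (fun y => c * sineD k y + v y).

(** The tolerance [eps] bounds the squared norm, which avoids square roots throughout. *)
Definition sine_closure A f := L2real f /\
  forall eps : R, 0 < eps -> exists2 v, sine_span A v &
    ip (fun x => f x - v x) (fun x => f x - v x) < eps.

Lemma sine_span_L2real A v : sine_span A v -> L2real v.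
Proof.
elim=> [|c k w _ _ Lw]; first exact: L2real0.
by apply: L2realD => //; apply: L2realZ; exact: L2real_sineD.
Qed.

Lemma sine_span_sineD A k : A k -> sine_span A (@sineD R k).
Proof.
move=> Ak; have := sine_spanS 1 Ak (sine_span0 A).
by under eq_fun do rewrite mul1r addr0.
Qed.

Lemma sine_spanD A v w : sine_span A v -> sine_span A w ->
  sine_span A (fun y => v y + w y).
Proof.
move=> + sw; elim=> [|c k v' Ak _ IH]; first by under eq_fun do rewrite add0r.
by under eq_fun do rewrite -addrA; exact: sine_spanS.
Qed.

Lemma sine_spanZ A a v : sine_span A v -> sine_span A (fun y => a * v y).
Proof.
elim=> [|c k v' Ak _ IH].
  by under eq_fun do rewrite mulr0; exact: sine_span0.
by under eq_fun do rewrite mulrDr mulrA; exact: sine_spanS.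
Qed.

(** Expand the nonnegative squared distance from [f] to its partial sum [S]: by orthonormality both
    [ip f S] and [ip S S] equal the sum of the squared coefficients. *)
Lemma bessel f n : L2real f ->
  \sum_(k < n) (ip (sineD k.+1) f) ^+ 2 <= ip f f.
Proof.
move=> Lf; pose c k := ip (sineD k.+1) f.
pose S y := \sum_(k < n) c k * sineD k.+1 y.
have Lc k : L2real (fun y => c k * sineD k.+1 y).
  by apply: L2realZ; exact: L2real_sineD.
have LS : L2real S by apply: (@L2real_sum _ _ (fun k y => c k * sineD k.+1 y)).
have Sh h : L2real h -> ip S h = \sum_(k < n) c k * ip (sineD k.+1) h.
  move=> Lh; rewrite (@ip_suml _ _ (fun k y => c k * sineD k.+1 y))//.
  by apply: eq_bigr => k _; rewrite ipZl//; exact: L2real_sineD.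
have Sk (k : 'I_n) : ip (sineD k.+1) S = c k.
  rewrite ipC Sh; last exact: L2real_sineD.
  rewrite (bigD1 k)//= ip_sineD// eqxx mulr1 big1 ?addr0// => j jk.
  rewrite ip_sineD// eqSS; case: eqP => [e|]; last by rewrite mulr0.
  by move: jk; rewrite -val_eqE/= e eqxx.
have := ip_ge0 (fun x => f x - S x); rewrite ip_sub// (ipC f) Sh// (Sh S)//.
have -> : \sum_(k < n) c k * ip (sineD k.+1) S = \sum_(k < n) c k ^+ 2.
  by apply: eq_bigr => k _; rewrite Sk expr2.
have -> : \sum_(k < n) c k * ip (sineD k.+1) f = \sum_(k < n) c k ^+ 2.
  by apply: eq_bigr => k _; rewrite expr2.
by rewrite -/c; set s := \sum_(k < n) _; lra.
Qed.

Lemma coef_sqr_le f k : (0 < k)%N -> L2real f -> (ip (sineD k) f) ^+ 2 <= ip f f.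
Proof.
case: k => // k _ Lf; apply: le_trans (bessel k.+1 Lf).
by rewrite big_ord_recr/= lerDr sumr_ge0// => i _; exact: sqr_ge0.
Qed.


(** The analogue of [ip_amgm] for coefficient sequences: a weighted inequality in each term, then
    Bessel for [f] and for [u]. The bound is uniform in [n]. *)
Lemma sum_coefM_le (d : R) f u n : 0 < d -> L2real f -> L2real u ->
  \sum_(k < n) `|ip (sineD k.+1) f * ip (sineD k.+1) u| <= d * ip f f + d^-1 * ip u u.
Proof.
move=> d0 Lf Lu; have di : 0 < d^-1 by rewrite invr_gt0.
apply: (@le_trans _ _ (d * (\sum_(k < n) (ip (sineD k.+1) f) ^+ 2)
    + d^-1 * (\sum_(k < n) (ip (sineD k.+1) u) ^+ 2))).
  rewrite !mulr_sumr -big_split/= ler_sum// => k _.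
  set a := ip _ f; set b := ip _ u.
  have h (t : R) : t ^+ 2 = b ^+ 2 -> a * t <= d * a ^+ 2 + d^-1 * b ^+ 2.
    move=> <-; have dd : d * d^-1 = 1 by rewrite mulfV// gt_eqF.
    have : 0 <= d * (a - d^-1 * t) ^+ 2 by rewrite mulr_ge0 ?sqr_ge0// ltW.
    have -> : d * (a - d^-1 * t) ^+ 2 = 
      d * a ^+ 2 - 2 * (d * d^-1) * (a * t) + (d * d^-1) * (d^-1 * t ^+ 2) by ring.
    rewrite dd; have := mulr_ge0 (ltW d0) (sqr_ge0 a); have := mulr_ge0 (ltW di) (sqr_ge0 t).
    by lra.
  rewrite ler_norml; apply/andP; split; last exact: h.
  by rewrite lerNl -mulrN; apply: h; rewrite sqrrN.
by apply: lerD; rewrite ler_pM2l//; exact: bessel.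
Qed.

Lemma is_cvg_sum_coefM f u : L2real f -> L2real u ->
  cvgn (series (fun k => `|ip (sineD k.+1) f * ip (sineD k.+1) u|)).
Proof.
move=> Lf Lu; apply: nondecreasing_is_cvgn.
  by apply: nondecreasing_series => n _ _; exact: normr_ge0.
exists (1 * ip f f + 1^-1 * ip u u) => _ [n _ <-].
by rewrite /series/= big_mkord; exact: sum_coefM_le.
Qed.

(** The coefficient vanishes on the span by orthogonality, and it is continuous for the norm by
    [coef_sqr_le]. *)
Lemma sine_closure_coef0 A f k : (0 < k)%N -> ~~ A k -> sine_closure A f ->
  ip (sineD k) f = 0.
Proof.
move=> k0 Ak [Lf cf]; apply/eqP; rewrite -sqrf_eq0; apply/eqP/le_anti.
rewrite sqr_ge0 andbT; apply/ler_addgt0Pr => e e0; rewrite add0r.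
have [v sv fv] := cf e e0; have Lv := sine_span_L2real sv.
have Ls := @L2real_sineD R k.
suff v0 : ip (sineD k) v = 0.
  have -> : ip (sineD k) f = ip (sineD k) (fun x => f x - v x).
    by rewrite ipC [RHS]ipC ipBl// (ipC v) v0 subr0.
  by apply: le_trans (ltW fv); apply: coef_sqr_le => //; exact: L2realB.
rewrite ipC; elim: sv => [|c j w Aj sw IH]; first exact: ip0l.
have Lj := @L2real_sineD R j; have Lw := sine_span_L2real sw.
rewrite ipDl ?ipZl ?IH ?addr0//; last exact: L2realZ.
rewrite ipC ip_sineD//; case: eqP => [e1|]; last by rewrite mulr0.
by move: Ak; rewrite e1 Aj.
Qed.

(** This is [B(F, u)(x)] for real functions. *)
Definition reflect_form F u (x : R) : R :=
  2^-1 * (ip (fun y => F (x - y)) u + ip (fun y => F (- x - y)) u).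

(** General term of the expansion of [B(F, u)(x)]; index [n] carries the frequency [n + 1]. *)
Definition form_term F u (x : R) (n : nat) : R :=
  sigma n.+1 * ip (sineD n.+1) F * ip (sineD n.+1) u * sineD n.+1 x.

Lemma form_termD F1 F2 u x n : L2real F1 -> L2real F2 ->
  form_term (fun y => F1 y + F2 y) u x n = form_term F1 u x n + form_term F2 u x n.
Proof.
move=> L1 L2; rewrite /form_term ipC ipDl//; last exact: L2real_sineD.
by rewrite (ipC F1) (ipC F2); ring.
Qed.

Lemma form_termZ c F u x n : L2real F ->
  form_term (fun y => c * F y) u x n = c * form_term F u x n.
Proof.
move=> L1; rewrite /form_term ipC ipZl//; last exact: L2real_sineD.
by rewrite (ipC F); ring.
Qed.

Lemma itvIN (x : R) : I x -> I (- x).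
Proof. by rewrite /itvI/= !in_itv/= => /andP[? ?]; apply/andP; split; lra. Qed.

Lemma sine_span_antiperiodic v : sine_span odd v -> forall y, v (y + 2) = - v y.
Proof.
elim=> [|c k w ok _ IH] y; first by rewrite oppr0.
by rewrite IH sineD_antiperiodic// opprD mulrN.
Qed.

Lemma reflect_formD F1 F2 u x : I x -> L2real u ->
  (forall y, F1 (y + 2) = - F1 y) -> (forall y, F2 (y + 2) = - F2 y) ->
  L2real F1 -> L2real F2 ->
  reflect_form (fun y => F1 y + F2 y) u x = reflect_form F1 u x + reflect_form F2 u x.
Proof.
move=> Ix Lu A1 A2 L1 L2; have Inx := itvIN Ix.
rewrite /reflect_form (ipDl (f := fun y => F1 (x - y)) (g := fun y => F2 (x - y)))//;
  try by apply antiperiodic_reflect.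
rewrite (ipDl (f := fun y => F1 (- x - y)) (g := fun y => F2 (- x - y)))//;
  try by apply antiperiodic_reflect.
by ring.
Qed.

Lemma reflect_formZ (c : R) F u x : I x -> L2real u ->
  (forall y, F (y + 2) = - F y) -> L2real F ->
  reflect_form (fun y => c * F y) u x = c * reflect_form F u x.
Proof.
move=> Ix Lu A1 L1; have Inx := itvIN Ix.
rewrite /reflect_form (ipZl c (f := fun y => F (x - y)))//;
  try by apply antiperiodic_reflect.
rewrite (ipZl c (f := fun y => F (- x - y)))//;
  try by apply antiperiodic_reflect.
by ring.
Qed.

(** Continuity of [B] in [F]: [ip_amgm] for each of the two reflections, whose squared norms are at
    most [3 * ip F F]. *)
Lemma reflect_form_le (d : R) F u x : 0 < d -> I x -> L2real u ->
  (forall y, F (y + 2) = - F y) -> L2real F ->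
  `|reflect_form F u x| <= 3 * d * ip F F + d^-1 * ip u u.
Proof.
move=> d0 Ix Lu A1 L1; have Inx := itvIN Ix.
have H z : I z -> `|ip (fun y => F (z - y)) u| <= 3 * d * ip F F + d^-1 * ip u u.
  move=> Iz; have [Lz le3] := antiperiodic_reflect A1 L1 Iz.
  apply: (le_trans (ip_amgm d0 Lz Lu)); rewrite lerD2r.
  by rewrite -mulrA mulrCA ler_pM2l.
rewrite /reflect_form normrM ger0_norm ?invr_ge0//.
have := ler_normD (ip (fun y => F (x - y)) u) (ip (fun y => F (- x - y)) u).
by have := H _ Ix; have := H _ Inx; lra.
Qed.

Lemma reflect_form_sineD k u x : odd k -> I x -> L2real u ->
  reflect_form (sineD k) u x = sigma k * sineD k x * ip (sineD k) u.
Proof.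
move=> ok Ix Lu; have Inx := itvIN Ix; have Ls := @L2real_sineD R k.
have A1 y := @sineD_antiperiodic R k y ok.
rewrite /reflect_form -ipDl//; try by apply antiperiodic_reflect.
under [X in ip X _]eq_fun do rewrite sineD_reflect// mulrA.
by rewrite ipZl//; field.
Qed.

(** A sine of frequency [k] contributes only to the term of index [k - 1], so the partial sums are
    constant once [n] reaches the largest frequency in [v]. *)
Lemma form_series_sine_span v u x : I x -> L2real u -> sine_span odd v ->
  exists N, forall n, (N <= n)%N -> series (form_term v u x) n = reflect_form v u x.
Proof.
move=> Ix Lu; elim=> [|c k w ok sw [N IH]].
  exists 0%N => n _; rewrite /series/= /form_term big1 => [|i _].
    by rewrite /reflect_form !ip0l addr0 mulr0.
  by rewrite ipC ip0l; ring.
have Lk := @L2real_sineD R k; have Lw := sine_span_L2real sw.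
have Lck := L2realZ c Lk.
have Ak y := @sineD_antiperiodic R k y ok.
exists (maxn N k) => n; rewrite geq_max => /andP[Nn kn].
rewrite reflect_formD//; last 2 first.
- by move=> y; rewrite Ak mulrN.
- exact: sine_span_antiperiodic.
rewrite -(IH n)// reflect_formZ// reflect_form_sineD//.
rewrite /series/= (eq_bigr (fun i => c * form_term (sineD k) u x i + form_term w u x i)); last first.
  by move=> i _; rewrite form_termD// form_termZ.
rewrite big_split/=; congr (_ + _); rewrite -mulr_sumr; congr (_ * _).
rewrite big_mkord; case: k ok kn {Lk Lck Ak} => // k _ kn.
rewrite (bigD1 (Ordinal kn))//= /form_term ip_sineD// eqxx mulr1 big1 ?addr0 => [|j jk].
  by ring.
rewrite ip_sineD// eqSS; case: eqP => [e|]; last by rewrite mulr0 !mul0r.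
by move: jk; rewrite -val_eqE/= e eqxx.
Qed.

Lemma form_term_le F u x n :
  `|form_term F u x n| <= `|ip (sineD n.+1) F * ip (sineD n.+1) u|.
Proof.
have -> : form_term F u x n =
    (ip (sineD n.+1) F * ip (sineD n.+1) u) * (sigma n.+1 * sineD n.+1 x).
  by rewrite /form_term; ring.
rewrite normrM ler_piMr// normrM mulr_ile1//; last exact: sineD_le1.
exact: sin_max.
Qed.

(** Split [F] into [v] in the span and a small remainder [G]. For [v] the partial sums are
    eventually exact; for [G] both the form and the partial sums are small, uniformly in [n]. *)
Lemma cvg_form_series F u x : I x -> L2real u -> (forall y, F (y + 2) = - F y) ->
  sine_closure odd F -> series (form_term F u x) @ \oo --> reflect_form F u x.
Proof.
move=> Ix Lu AF [LF cF]; apply/cvgrPdist_lt => e e0.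
pose U := ip u u; have U0 : 0 <= U := ip_ge0 u.
(* This weight brings [d^-1 * U] below [e / 4], the summand 1 keeping [d] positive when [U = 0].
   With [ip G G < e / (16 * d)], the form is below [3 e / 16 + e / 4] and the partial sums below
   [e / 16 + e / 4], in total less than [e]. *)
pose d := 4 * (U + 1) / e.
have d0 : 0 < d by rewrite /d divr_gt0// mulr_gt0//; lra.
have dU : d^-1 * U <= e / 4.
  have -> : e / 4 = d^-1 * (U + 1).
    by rewrite /d invf_div; field; rewrite gt_eqF//; lra.
  by rewrite ler_wpM2l ?invr_ge0 1?ltW//; lra.
have e1 : 0 < e / (16 * d) by rewrite divr_gt0// mulr_gt0.
have [v sv Fv] := cF _ e1; have Lv := sine_span_L2real sv.
have Av := sine_span_antiperiodic sv.
have [N HN] := form_series_sine_span Ix Lu sv.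
pose G y := F y - v y; have LG : L2real G := L2realB LF Lv.
have AG y : G (y + 2) = - G y by rewrite /G AF Av opprD.
have FG : F = (fun y => G y + v y) by apply/funext => y; rewrite /G subrK.
have NG : d * ip G G < e / 16.
  have -> : e / 16 = d * (e / (16 * d)) by field; rewrite gt_eqF.
  by rewrite ltr_pM2l.
near=> n.
have nN : (N <= n)%N by near: n; exact: nbhs_infty_ge.
rewrite FG reflect_formD// -(HN n)//.
have -> : series (form_term (fun y => G y + v y) u x) n =
    series (form_term G u x) n + series (form_term v u x) n.
  by rewrite /series/= -big_split/=; apply: eq_bigr => i _; rewrite form_termD.
rewrite opprD addrACA subrr addr0; apply: le_lt_trans (ler_normB _ _) _.
have h1 := reflect_form_le d0 Ix Lu AG LG.
have h2 : `|series (form_term G u x) n| <= d * ip G G + d^-1 * ip u u.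
  rewrite /series/= big_mkord; apply: le_trans (ler_norm_sum _ _ _) _.
  apply: le_trans (sum_coefM_le n d0 LG Lu); apply: ler_sum => k _.
  exact: form_term_le.
rewrite -/U in h1 h2; rewrite -mulrA in h1; lra.
Unshelve. all: by end_near.
Qed.

End SineClosure.

(** * Bounded approximation by odd sines *)

Section Density.
Context {R : realType}.
Set Implicit Arguments.
Unset Strict Implicit.
Local Notation mu := (@lebesgue_measure R).
Local Notation I := (@itvI R).
Implicit Types (A : pred nat) (f g h u v : R -> R).

Lemma sine_closure_closed A f : L2real f ->
  (forall eps : R, 0 < eps -> exists2 g, sine_closure A g &
     ip (fun x => f x - g x) (fun x => f x - g x) < eps) -> sine_closure A f.
Proof.
(* The triangle inequality for squared norms costs a factor 2, hence the quarters. *)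
move=> Lf H; split=> // e e0; have e4 : 0 < e / 4 by lra.
have [g [Lg cg] fg] := H _ e4; have [v sv gv] := cg _ e4.
exists v => //; apply: le_lt_trans (ip_triangle Lf Lg (sine_span_L2real sv)) _; lra.
Qed.

Lemma sine_span_closure A v : sine_span A v -> sine_closure A v.
Proof.
move=> sv; split; first exact: sine_span_L2real sv.
move=> e e0; exists v => //; under [X in ip X _]eq_fun do rewrite subrr.
by rewrite ip0l.
Qed.

Lemma sine_closure_ae A f g : sine_closure A f -> measurable_fun I g ->
  {ae mu, forall x, I x -> f x = g x} -> sine_closure A g.
Proof.
move=> cf mg fg; have [Lg ip0] := ip_aez (proj1 cf) fg mg.
apply: sine_closure_closed => // e e0; exists f => //.
suff -> : ip (fun x => g x - f x) (fun x => g x - f x) = 0 by [].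
by rewrite -ip0; apply: eq_Rintegral => x _; ring.
Qed.

Lemma sine_closure_eq A f g : sine_closure A f -> (forall x, I x -> f x = g x) ->
  sine_closure A g.
Proof.
move=> cf fg; apply: (sine_closure_ae cf).
  by apply: (eq_measurable_fun _ _ (proj1 (proj1 cf))) => x; rewrite inE => /fg.
by apply: aeW => x; exact: fg.
Qed.

Lemma sine_closureD A f g : sine_closure A f -> sine_closure A g ->
  sine_closure A (fun x => f x + g x).
Proof.
move=> [Lf cf] [Lg cg]; split=> [|e e0]; first exact: L2realD.
have e4 : 0 < e / 4 by lra.
have [v sv fv] := cf _ e4; have [w sw gw] := cg _ e4.
have Lv := sine_span_L2real sv; have Lw := sine_span_L2real sw.
exists (fun x => v x + w x); first exact: sine_spanD.
have -> : (fun x => f x + g x - (v x + w x)) = (fun x => (f x - v x) + (g x - w x)).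
  by apply/funext => x; ring.
apply: le_lt_trans (ip_add_le (L2realB Lf Lv) (L2realB Lg Lw)) _; lra.
Qed.

Lemma sine_closureZ A (c : R) f : sine_closure A f -> sine_closure A (fun x => c * f x).
Proof.
move=> [Lf cf]; split=> [|e e0]; first exact: L2realZ.
have c1 : 0 < c ^+ 2 + 1 by have := sqr_ge0 c; lra.
have e4 : 0 < e / (c ^+ 2 + 1) by rewrite divr_gt0.
have [v sv fv] := cf _ e4; have Lv := sine_span_L2real sv.
exists (fun x => c * v x); first exact: sine_spanZ.
have -> : (fun x => c * f x - c * v x) = (fun x => c * (f x - v x)).
  by apply/funext => x; ring.
have LB := L2realB Lf Lv.
rewrite ipZl//; last exact: L2realZ.
rewrite ipC ipZl// mulrA -expr2.
move: fv; rewrite ltr_pdivlMr// => fv; apply: le_lt_trans fv.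
by rewrite mulrC ler_wpM2l ?ip_ge0//; lra.
Qed.

Lemma sine_closureB A f g : sine_closure A f -> sine_closure A g ->
  sine_closure A (fun x => f x - g x).
Proof.
move=> cf /(sine_closureZ (-1)) cg; apply: sine_closure_eq (sine_closureD cf cg) _.
by move=> x _; rewrite mulN1r.
Qed.

Lemma sine_closure_sum A (T : Type) (s : seq T) (F : T -> R -> R) :
  (forall t, sine_closure A (F t)) -> sine_closure A (fun y => \sum_(t <- s) F t y).
Proof.
move=> cF; elim: s => [|t s IH].
  under eq_fun do rewrite big_nil; apply: sine_span_closure; exact: sine_span0.
by under eq_fun do rewrite big_cons; exact: sine_closureD.
Qed.

(** Dominated convergence for [(f - g_n)^2], which is at most [4 h^2]. *)
Lemma sine_closure_lim A (g_ : nat -> R -> R) f h :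
  (forall n, sine_closure A (g_ n)) -> measurable_fun I f -> L2real h ->
  (forall x, I x -> `|f x| <= h x) ->
  (forall n x, I x -> `|g_ n x| <= h x) ->
  {ae mu, forall x, I x -> g_ ^~ x @ \oo --> f x} -> sine_closure A f.
Proof.
move=> cg mf Lh fh gh gf.
have ih := integrableZl measurable_itvI 4 (L2real_sqr Lh).
have Lf : L2real f.
  apply: (L2real_le_integrable mf ih) => x Ix /=.
  have := fh _ Ix; rewrite ler_norml => /andP[? ?]; rewrite !expr2; nra.
apply: sine_closure_closed => // e e0.
pose d n x := (f x - g_ n x) * (f x - g_ n x).
have md n : measurable_fun I (EFin \o d n).
  by apply/measurable_EFinP; apply: measurable_funM; apply: measurable_funB => //;
     exact: (proj1 (proj1 (cg n))).
have dcv : {ae mu, forall x, I x -> (EFin \o d n) x @[n --> \oo] --> cst 0%E x}.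
  apply: ae_sub gf => x + Ix => /(_ Ix) gx /=.
  apply: cvg_EFin; first exact: nearW.
  have h0 : f x - g_ n x @[n --> \oo] --> 0.
    by rewrite -[X in _ --> X](subrr (f x)); apply: cvgB => //; exact: cvg_cst.
  by rewrite -[X in _ --> X](mul0r 0); exact: cvgM.
have dle : {ae mu, forall x n, I x -> (`|(EFin \o d n) x| <= 4 * ((h x ^+ 2)%R)%:E)%E}.
  apply: aeW => x n Ix /=; rewrite lee_fin.
  have := fh _ Ix; have := gh n _ Ix; rewrite !ler_norml /d -expr2 => /andP[? ?] /andP[? ?].
  have := sqr_ge0 (f x - g_ n x); rewrite !expr2 => ?.
  by apply/andP; split; nra.
have mc0 : measurable_fun I (cst 0%E : R -> \bar R) by exact: measurable_cst.
have [_ _ H] := dominated_convergence measurable_itvI md mc0 dcv ih dle.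
rewrite integral0 in H.
have /fine_cvg/cvgrPdist_lt/(_ _ e0)[N _ HN] := H.
exists (g_ N) => //; have := HN N (leqnn N); rewrite sub0r normrN.
by apply: le_lt_trans; exact: ler_norm.
Qed.

(** Since [e_1^2 = (1 - cos (pi (y + 1))) / 2], multiplication by it turns the frequency [k] into
    [k], [k + 2] and [k - 2], all of the same parity. *)
Lemma sine_span_mul_sqr v : sine_span odd v ->
  sine_span odd (fun y => sineD 1 y ^+ 2 * v y).
Proof.
elim=> [|c k w ok sw IH].
  by under eq_fun do rewrite mulr0; exact: sine_span0.
under eq_fun do rewrite mulrDr; apply: sine_spanD => //.
under eq_fun do rewrite mulrCA; apply: sine_spanZ.
have E y : sineD 1 y ^+ 2 * sineD k y = 2^-1 * sineD k y - 4^-1 * sineD (k + 2) y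
   - 4^-1 * sin ((k%:R - 2) * pi / 2 * (y + 1)).
  rewrite /sineD natrD mul1r; set t := pi / 2 * (y + 1).
  have -> : (k%:R + 2) * pi / 2 * (y + 1) = k%:R * pi / 2 * (y + 1) + (t + t) by rewrite /t; ring.
  have -> : (k%:R - 2) * pi / 2 * (y + 1) = k%:R * pi / 2 * (y + 1) - (t + t) by rewrite /t; ring.
  rewrite !sinD cosN sinN !cosD !sinD.
  have := cos2Dsin2 t; set s := sin t; set c' := cos t => cs.
  have -> : c' * c' = 1 - s ^+ 2 by rewrite -cs; ring.
  by field.
under eq_fun do rewrite E.
have sk := sine_span_sineD ok.
have sk2 : sine_span odd (@sineD R (k + 2)) by apply: sine_span_sineD; rewrite oddD ok.
have N a u' : sine_span odd u' -> sine_span odd (fun y => - (a * u' y)).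
  by move=> /(sine_spanZ (- a)); under eq_fun do rewrite mulNr.
apply: sine_spanD; first by apply: sine_spanD; [exact: sine_spanZ | exact: N].
(* The difference [k - 2] is taken in the reals: for [k = 1] the frequency -1 gives [- e_1], and
   otherwise it is again an odd natural number. *)
apply: N; case: k ok {E sk sk2} => [|[|k]] // ok.
  have -> : (fun y : R => sin ((1 - 2) * pi / 2 * (y + 1))) = (fun y => -1 * sineD 1 y).
    apply/funext => y; rewrite /sineD mulN1r -sinN; congr sin; ring.
  by apply: sine_spanZ; exact: sine_span_sineD.
have -> : (fun y : R => sin ((k.+2%:R - 2) * pi / 2 * (y + 1))) = sineD k.
  by apply/funext => y; rewrite /sineD -addn2 natrD addrK.
by apply: sine_span_sineD; rewrite /= negbK in ok.
Qed.

(** The factor is a polynomial in [e_1^2]. The outer induction peels off one of the [m] factors, the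
    inner one multiplies [n] times by [a e_1^2]. *)
Lemma sine_span_power v (a : R) (n m : nat) : sine_span odd v ->
  sine_span odd (fun y => (1 - (a * sineD 1 y ^+ 2) ^+ n) ^+ m * v y).
Proof.
move=> sv; elim: m => [|m IH]; first by under eq_fun do rewrite expr0 mul1r.
move: IH; set u := fun y => _ => su.
have -> : (fun y => (1 - (a * sineD 1 y ^+ 2) ^+ n) ^+ m.+1 * v y) =
   (fun y => u y + (- 1) * ((a * sineD 1 y ^+ 2) ^+ n * u y)).
  by apply/funext => y; rewrite /u exprS; ring.
apply: sine_spanD => //; apply: sine_spanZ.
elim: n {v sv m} u su => [|n IH] u su; first by under eq_fun do rewrite expr0 mul1r.
have -> : (fun y => (a * sineD 1 y ^+ 2) ^+ n.+1 * u y) =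
  (fun y => a * (sineD 1 y ^+ 2 * ((a * sineD 1 y ^+ 2) ^+ n * u y))).
  by apply/funext => y; rewrite exprS; ring.
by apply: sine_spanZ; apply: sine_span_mul_sqr; exact: IH.
Qed.

(** Bernoulli's inequality and its companion [(1 - t)^m <= 1 / (1 + m t)]; they control the power
    from below when [m t] is small and from above when it is large. *)
Lemma bernoulli_power (t : R) (m : nat) : 0 <= t <= 1 ->
  [/\ 1 - m%:R * t <= (1 - t) ^+ m, 0 <= (1 - t) ^+ m, (1 - t) ^+ m <= 1 &
      (1 - t) ^+ m * (1 + m%:R * t) <= 1].
Proof.
move=> /andP[t0 t1].
have p0 : 0 <= 1 - t by lra.
have p1 : 1 - t <= 1 by lra.
elim: m => [|m [h1 h2 h3 h4]]; first by rewrite expr0 !mul0r; split; lra.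
have mt : 0 <= m%:R * t by rewrite mulr_ge0.
have q0 := mulr_ge0 h2 mt; have q1 := mulr_ge0 h2 t0.
have q2 : 0 <= (1 - t) ^+ m * t * t by rewrite mulr_ge0.
have q3 : 0 <= (1 - t) ^+ m * (m%:R * t) * t by rewrite mulr_ge0.
rewrite exprS -natr1; move: h1 h2 h3 h4 q0 q1 q2 q3; set p := (1 - t) ^+ m => h1 h2 h3 h4 q0 q1 q2 q3.
have q4 : p * t <= t by rewrite ler_piMl.
split.
- by rewrite mulrDl mul1r mulrBl mul1r (mulrC t); lra.
- exact: mulr_ge0.
- by rewrite mulrBl mul1r (mulrC t); lra.
- have -> : (1 - t) * p * (1 + (m%:R + 1) * t) =
     p * (1 + m%:R * t) - (p * t * t + p * (m%:R * t) * t) by ring.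
  lra.
Qed.

(** A device of the elementary proof of the Stone-Weierstrass theorem: [bernoulli_power] at [t^n]
    and [k^n] involves only [(k t)^n], which tends to 0 if [k t < 1] and to infinity if
    [k t > 1]. *)
Lemma cvg_power_threshold (t : R) (k : nat) : 0 <= t <= 1 ->
  (k%:R * t < 1 -> (1 - t ^+ n) ^+ (k ^ n) @[n --> \oo] --> (1 : R)) /\
  (1 < k%:R * t -> (1 - t ^+ n) ^+ (k ^ n) @[n --> \oo] --> (0 : R)).
Proof.
move=> /andP[t0 t1].
have tn n : 0 <= t ^+ n <= 1 by rewrite exprn_ge0//= exprn_ile1.
have B n := @bernoulli_power (t ^+ n) (k ^ n) (tn n).
have e n : (k ^ n)%:R * t ^+ n = (k%:R * t) ^+ n by rewrite natrX exprMn.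
split=> kt.
- apply: (@squeeze_cvgr _ _ _ _ (fun n => 1 - (k%:R * t) ^+ n) (cst 1)); last exact: cvg_cst.
    by apply: nearW => n; have [h1 _ h3 _] := B n; rewrite -e h1.
  rewrite -[X in _ --> X]subr0; apply: cvgB; first exact: cvg_cst.
  by apply: cvg_expr; rewrite ger0_norm ?mulr_ge0.
- apply: (@squeeze_cvgr _ _ _ _ (cst 0) (fun n => (k%:R * t)^-1 ^+ n)); first 2 last.
  + by apply: cvg_expr; rewrite ger0_norm ?invr_ge0 ?mulr_ge0// invf_lt1// (lt_trans _ kt).
  + apply: nearW => n; have [_ h2 _ h4] := B n; rewrite h2/=.
    have kn : 0 < (k%:R * t) ^+ n by rewrite exprn_gt0// (lt_trans _ kt).
    rewrite exprVn -[leRHS]mul1r ler_pdivlMr//; apply: le_trans h4.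
    by rewrite e ler_wpM2l// lerDr.
  + exact: cvg_cst.
Qed.
End Density.

(** * Density in the even functions *)

Section EvenDensity.
Import HBNNSimple.
Context {R : realType}.
Set Implicit Arguments.
Unset Strict Implicit.
Local Notation mu := (@lebesgue_measure R).
Local Notation I := (@itvI R).
Implicit Types (f g h : R -> R).

Lemma sineD1_gt0 (y : R) : I y -> 0 < sineD 1 y.
Proof.
rewrite /itvI/= in_itv/= => /andP[y1 y2]; have p0 := pi_gt0 R.
rewrite /sineD mul1r; apply: sin_gt0_pi; apply/andP; split.
  by rewrite mulr_gt0// ?divr_gt0//; lra.
have -> : pi / 2 * (y + 1) = pi + pi * ((y - 1) / 2) by field.
by rewrite gtrDl nmulr_llt0//; lra.
Qed.

Lemma sineD1_abs (y : R) : sineD 1 y = cos (pi / 2 * `|y|).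
Proof.
rewrite sineD_odd// /sigma mul1r sin_pihalf mul1r.
by case: (ger0P y) => // _; rewrite mulrN cosN.
Qed.

(** The cosine decreases on [[0, pi]], so a threshold on [e_1] is a threshold on the absolute
    value. *)
Lemma sineD1_lt (y b : R) : `|y| <= 1 -> 0 <= b <= 1 ->
  (sineD 1 y < sineD 1 b) = (b < `|y|).
Proof.
move=> y1 /andP[b0 b1]; have p0 := pi_gt0 R; have yn := normr_ge0 y.
have p2 : 0 < pi / 2 :> R by rewrite divr_gt0.
have H (t : R) : 0 <= t -> t <= 1 -> pi / 2 * t \in `[0, pi].
  move=> t0 t1; rewrite in_itv/= mulr_ge0//=; last exact: ltW.
  by have := ler_wpM2l (ltW p2) t1; lra.
by rewrite !sineD1_abs (ger0_norm b0) ltr_cos ?H// ltr_pM2l.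
Qed.

Lemma ae_neq (a : R) : {ae mu, forall x, x <> a}.
Proof.
exists [set a]; split; [exact: measurable_set1 | exact: lebesgue_measure_set1 |].
by move=> x /= /contrapT.
Qed.

Lemma sine_closure_ray (b : R) : 0 <= b < 1 ->
  sine_closure odd (fun y => if b < `|y| then sineD 1 y else 0).
Proof.
move=> /andP[b0 b1]; pose s := sineD 1 b ^+ 2.
have Ib : I b by rewrite /itvI/= in_itv/=; apply/andP; split; lra.
have wb := sineD1_gt0 Ib.
have s0 : 0 < s by rewrite exprn_gt0.
(* With [a = 1 / (k s)] the quantity [a e_1^2] stays in [[0, 1]], because [k s >= 1], while
   [k (a e_1^2) = e_1^2 / s] passes 1 exactly where the absolute value of [y] is [b]. *)
have [k ks] : exists k : nat, 1 <= k%:R * s.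
  exists (Num.truncn s^-1).+1; rewrite -ler_pdivrMr// div1r; exact: ltW (truncnS_gt _).
have k0 : 0 < k%:R :> R by rewrite ltNge; apply/negP => k0; have := ler_wpM2r (ltW s0) k0; lra.
pose a := (k%:R * s)^-1.
have a0 : 0 < a by rewrite invr_gt0 (lt_le_trans _ ks).
have a1 : a <= 1 by rewrite invf_le1// (lt_le_trans _ ks).
have kaE (t : R) : k%:R * (a * t) = t / s.
  by rewrite /a; field; rewrite !gt_eqF.
have w01 y : 0 <= a * sineD 1 y ^+ 2 <= 1.
  have q0 := sqr_ge0 (sineD 1 y : R).
  have q1 : sineD 1 y ^+ 2 <= 1 :> R.
    by rewrite -real_normK ?num_real// expr_le1// sineD_le1.
  by rewrite mulr_ge0 ?(ltW a0)//= mulr_ile1 ?(ltW a0).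
have pn n y : 0 <= (a * sineD 1 y ^+ 2) ^+ n <= 1.
  by have /andP[h1 h2] := w01 y; rewrite exprn_ge0//= exprn_ile1.
have p01 n y := @bernoulli_power R ((a * sineD 1 y ^+ 2) ^+ n) (k ^ n) (pn n y).
apply: (@sine_closure_lim _ _ (fun n y =>
   (1 - (a * sineD 1 y ^+ 2) ^+ n) ^+ (k ^ n) * sineD 1 y) _ (cst 1)).
- by move=> n; apply: sine_span_closure; apply: sine_span_power; exact: sine_span_sineD.
- apply: measurable_funTS; apply: measurable_fun_ifT => //.
    apply: measurable_fun_ltr => //; exact: normr_measurable.
  exact: measurable_sineD.
- by apply: (@L2real_bounded _ _ 1) => // x _; rewrite normr1.
- by move=> x _; case: ifP; rewrite ?normr0 ?sineD_le1//=.
- move=> n x _; rewrite normrM; apply: mulr_ile1 => //; last exact: sineD_le1.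
  by have [_ h2 h3 _] := p01 n x; rewrite ger0_norm.
(* At the threshold itself [cvg_power_threshold] gives no limit; the two points [b] and [- b] form a
   null set. *)
- have ae2 : {ae mu, forall x, x <> b /\ x <> - b}.
    exact: (@filterI _ _ (ae_filter_ringOfSetsType mu) _ _ (ae_neq b) (ae_neq (- b))).
  apply: ae_sub ae2 => x [xb xNb] Ix.
  have x1 : `|x| < 1 by move: Ix; rewrite /itvI/= in_itv/= ltr_norml.
  have wx := sineD1_gt0 Ix.
  have [h1 h0] := cvg_power_threshold k (w01 x).
  rewrite !kaE ltr_pdivrMr// mul1r ltr_pdivlMr// mul1r in h1 h0.
  case: ifPn => bx.
    rewrite -[X in _ --> X]mul1r; apply: cvgM; last exact: cvg_cst.
    have sl : (sineD 1 x < sineD 1 b) = (b < `|x|).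
      by apply: sineD1_lt; [exact: ltW | rewrite b0 ltW].
    by apply: h1; rewrite /s ltr_sqr ?nnegrE ?ltW// sl.
  rewrite -[X in _ --> X](mul0r (sineD 1 x)); apply: cvgM; last exact: cvg_cst.
  apply: h0; rewrite /s ltr_sqr ?nnegrE ?ltW//.
  have xb' : `|x| < b.
    rewrite lt_neqAle leNgt bx andbT; apply/eqP => e.
    by case: (ger0P x) e => _ e; [exact: xb | apply: xNb; rewrite -e opprK].
  have -> : sineD 1 x = sineD 1 `|x| by rewrite !sineD1_abs normr_id.
  have sl : (sineD 1 b < sineD 1 `|x|) = (`|x| < `|b|).
    by apply: sineD1_lt; [rewrite ger0_norm// ltW | rewrite normr_ge0 ltW].
  by rewrite sl (ger0_norm b0).
Qed.

Lemma measurable_mul_indic_abs (E : set R) : measurable E ->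
  measurable_fun I (fun y => sineD 1 y * \1_E `|y| : R).
Proof.
move=> mE; apply: measurable_funM; first exact: measurable_sineD.
apply: measurable_funTS.
have m1 : measurable_fun [set: R] (\1_E : R -> R) by exact: measurable_indic.
have m2 : measurable_fun [set: R] (@Num.norm R R) by exact: normr_measurable.
exact: (measurableT_comp m1 m2).
Qed.

Lemma sine_closure_indic (E : set R) : measurable E ->
  sine_closure odd (fun y => sineD 1 y * \1_E `|y| : R).
Proof.
have w1 : sine_closure odd (@sineD R 1).
  by apply: sine_span_closure; exact: sine_span_sineD.
have mS := RGenOInfty.measurableE R.
(* The open rays form a pi-system generating the Borel sets; the sets with the required property
   form a lambda-system. *)
move=> mE; move: (mE); rewrite [X in X E]mS; move: {mE} E.
apply: dynkin_induction; first exact: mS.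
- move=> _ _ [a ->] [b ->]; exists (Num.max a b).
  apply/seteqP; split => y /=; rewrite !in_itv/= !andbT gt_max.
    by move=> [-> ->].
  by move/andP.
- by apply: sine_closure_eq w1 _ => y _; rewrite indicT mulr1.
- move=> _ [b ->].
  (* For [b < 0] the ray contains every absolute value and the function is [e_1]; for [b >= 1] it
     meets none from [I] and the function is 0. In between [sine_closure_ray] applies. *)
  have [b0|b0] := ltP b 0.
    apply: sine_closure_eq w1 _ => y _; rewrite indicE mem_set ?mulr1//=.
    by rewrite in_itv/= andbT (lt_le_trans b0).
  have [b1|b1] := ltP b 1; last first.
    apply: sine_closure_eq (sine_closureZ 0 w1) _ => y; rewrite /itvI/= in_itv/= -ltr_norml => y1.
    rewrite mul0r indicE memNset ?mulr0//= in_itv/= andbT => by_.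
    by have := lt_trans by_ y1; lra.
  have hb : 0 <= b < 1 by rewrite b0.
  apply: sine_closure_eq (sine_closure_ray hb) _ => y _; rewrite indicE; case: ifPn => by_.
    by rewrite mem_set ?mulr1//= in_itv/= andbT.
  by rewrite memNset ?mulr0//= in_itv/= andbT; apply/negP.
- move=> S mS' cS; apply: sine_closure_eq (sine_closureB w1 cS) _ => y _.
  by rewrite !indicE in_setC; case: (_ \in _); rewrite /= ?mulr1 ?mulr0 ?subrr ?subr0.
- move=> F mF tF cF.
  (* By disjointness the finite sums of indicators take only the values 0 and 1 and are eventually
     constant at each point, so they converge boundedly to the indicator of the union. *)
  have S0 n t : ~ (\bigcup_k F k) t -> \sum_(k < n) \1_(F k) t = 0 :> R.
    move=> Ft; rewrite big1// => k _; rewrite indicE memNset// => Fkt.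
    by apply: Ft; exists k.
  have S1 n t k0 : F k0 t -> \sum_(k < n) \1_(F k) t = (k0 < n)%N%:R :> R.
    move=> Ft; have one k : \1_(F k) t = (k == k0)%:R :> R.
      rewrite indicE; case: eqP => [->|kk0]; first by rewrite mem_set.
      rewrite memNset// => Fkt; apply: kk0; apply: tF => //; by exists t.
    under eq_bigr do rewrite one.
    have [k0n|nk0] := ltnP k0 n; last first.
      rewrite big1// => k _; case: eqP => // e.
      by have := ltn_ord k; rewrite e ltnNge nk0.
    rewrite (bigD1 (Ordinal k0n))//= eqxx big1 ?addr0// => k.
    by rewrite -val_eqE/= => /negbTE ->.
  apply: (@sine_closure_lim _ _ (fun n y => \sum_(k < n) (sineD 1 y * \1_(F k) `|y|)) _ (cst 1)).
  + by move=> n; apply: (@sine_closure_sum _ _ _ _ (fun (k : 'I_n) y => sineD 1 y * \1_(F k) `|y|)).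
  + by apply: measurable_mul_indic_abs; exact: bigcup_measurable.
  + by apply: (@L2real_bounded _ _ 1) => // x _; rewrite normr1.
  + move=> x _; rewrite normrM mulr_ile1 ?sineD_le1//.
    by rewrite indicE; case: (_ \in _); rewrite ?normr1 ?normr0.
  + move=> n x _; rewrite -mulr_sumr normrM mulr_ile1 ?sineD_le1//.
    have [[k0 _ Fk]|/S0 ->] := pselect ((\bigcup_k F k) `|x|); last by rewrite normr0.
    by rewrite (S1 _ _ _ Fk); case: (_ < _)%N; rewrite ?normr1 ?normr0.
  + apply: aeW => x Ix; under eq_fun do rewrite -mulr_sumr.
    apply: cvgM; first exact: cvg_cst.
    have [Ft|Ft] := pselect ((\bigcup_k F k) `|x|).
      rewrite indicE mem_set//; case: (Ft) => k0 _ Fk.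
      apply: cvg_near_cst; exists k0.+1 => // n /= kn.
      by rewrite (S1 _ _ _ Fk) kn.
    rewrite indicE memNset//; apply: cvg_near_cst; apply: nearW => n.
    by rewrite S0.
Qed.

(** A function with finite range is a finite combination of the indicators of its level sets. *)
Lemma sine_closure_simple (g : R -> R) : measurable_fun [set: R] g ->
  finite_set (range g) -> sine_closure odd (fun y => sineD 1 y * g `|y|).
Proof.
move=> mg fg.
have gE y : g y = \sum_(r <- finmap.enum_fset (fset_set (range g))) r * \1_(g @^-1` [set r]) y.
  rewrite (bigD1_seq (g y))/= ?finmap.fset_uniq//; last first.
    by rewrite in_fset_set// inE; exists y.
  rewrite indicE mem_set// mulr1 big1 ?addr0// => r ry.
  by rewrite indicE memNset ?mulr0// => /= e; rewrite e eqxx in ry.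
apply: (@sine_closure_eq _ _ (fun y => \sum_(r <- finmap.enum_fset (fset_set (range g)))
    r * (sineD 1 y * \1_(g @^-1` [set r]) `|y|))).
  apply: sine_closure_sum => r; apply: sine_closureZ; apply: sine_closure_indic.
  by rewrite -[X in measurable X]setTI; exact: mg.
by move=> y _; rewrite [in RHS]gE mulr_sumr; apply: eq_bigr => r _; rewrite mulrCA.
Qed.

Lemma sine_closure_even_ge0 f : L2real f -> (forall x, I x -> 0 <= f x) ->
  {ae mu, forall x, I x -> f (- x) = f x} -> sine_closure odd f.
Proof.
move=> Lf f0 fe.
(* The quotient may fail to be square integrable near the endpoints. Domination is only used after
   multiplying back by [e_1], when simple functions below [g] yield functions below [f] at the
   absolute value. *)
pose g := (fun r => f r / sineD 1 r) \_ I.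
have mg : measurable_fun [set: R] g.
  apply/(measurable_restrictT _ _).1 => //; first exact: measurable_itvI.
  apply: measurable_funM; first by case: Lf.
  apply: (eq_measurable_fun (fun r => sineD 1 r `^ (-1))).
    by move=> r; rewrite inE => Ir; rewrite powR_inv1// ltW// sineD1_gt0.
  by apply: (measurableT_comp (measurable_powR _)); exact: measurable_sineD.
have g0 r : 0 <= g r.
  rewrite /g patchE; case: ifPn => // /set_mem Ir.
  by rewrite divr_ge0 ?f0// ltW// sineD1_gt0.
have Iabs x : I x -> I `|x|.
  rewrite /itvI/= !in_itv/= -ltr_norml => x1; rewrite x1 andbT.
  by have := normr_ge0 x; lra.
have gw x : I x -> sineD 1 x * g `|x| = f `|x|.
  move=> Ix; have Ia := Iabs _ Ix; rewrite /g patchE mem_set//.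
  have -> : sineD 1 x = sineD 1 `|x| :> R by rewrite !sineD1_abs normr_id.
  by rewrite mulrCA mulfV ?mulr1// gt_eqF// sineD1_gt0.
have mgE : measurable_fun [set: R] (EFin \o g) by exact/measurable_EFinP.
pose h := nnsfun_approx measurableT mgE.
have ch x : (fun n => h n x) @ \oo --> g x.
  have := @cvg_nnsfun_approx _ _ R _ measurableT _ mgE (fun x _ => g0 x) x Logic.I.
  by move/fine_cvg.
have hle n x : h n x <= g x.
  have nd : nondecreasing_seq (fun n => h n x).
    by move=> a b ab; apply/lefP/nd_nnsfun_approx.
  have cn : cvgn (fun n => h n x) by apply/cvg_ex; exists (g x); exact: ch.
  by have := nondecreasing_cvgn_le nd cn n; rewrite (cvg_lim _ (ch x)).
have mfa : measurable_fun I (fun y => f `|y|).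
  apply: (eq_measurable_fun (fun y => sineD 1 y * g `|y|)).
    by move=> y; rewrite inE; exact: gw.
  apply: measurable_funM; first exact: measurable_sineD.
  by apply: measurable_funTS; apply: measurableT_comp => //; exact: normr_measurable.
(* Evenness holds only almost everywhere, so the approximation is carried out for the exactly even
   representative and transferred to [f] at the end. *)
have ffa : {ae mu, forall x, I x -> f x = f `|x|}.
  by apply: ae_sub fe => x + Ix => /(_ Ix); case: (ger0P x).
have [Lfa _] := ip_aez Lf ffa mfa.
have cfa : sine_closure odd (fun y => f `|y|).
  apply: (@sine_closure_lim _ _ (fun n y => sineD 1 y * h n `|y|) _ (fun y => f `|y|)) => //.
  - by move=> n; apply: sine_closure_simple; [exact: measurable_funP | exact: fimfunP].
  - by move=> x Ix; rewrite ger0_norm// f0//; exact: Iabs.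
  - move=> n x Ix; have w0 := sineD1_gt0 Ix; rewrite ger0_norm; last by rewrite mulr_ge0// ltW.
    by rewrite -gw// ler_pM2l.
  - apply: aeW => x Ix; rewrite -gw//; apply: cvgM; first exact: cvg_cst.
    exact: ch.
apply: sine_closure_ae cfa _ _; first by case: Lf.
by apply: ae_sub ffa => x + Ix => /(_ Ix).
Qed.

(** Twice the positive part and twice the negative part are nonnegative and even; [f] is half their
    difference. *)
Lemma sine_closure_even f : L2real f ->
  {ae mu, forall x, I x -> f (- x) = f x} -> sine_closure odd f.
Proof.
move=> Lf fe; have Lfa : L2real (fun x => `|f x|).
  apply: (L2real_le_integrable _ (L2real_sqr Lf)).
    by apply: measurableT_comp; [exact: normr_measurable | case: Lf].
  by move=> x _; rewrite real_normK ?num_real.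
have cp : sine_closure odd (fun x => `|f x| + f x).
  apply: sine_closure_even_ge0; first exact: L2realD.
    by move=> x _; have := ler_norm (- f x); rewrite normrN; lra.
  by apply: ae_sub fe => x + Ix => /(_ Ix) ->.
have cn : sine_closure odd (fun x => `|f x| - f x).
  apply: sine_closure_even_ge0; first exact: L2realB.
    by move=> x _; have := ler_norm (f x); lra.
  by apply: ae_sub fe => x + Ix => /(_ Ix) ->.
apply: sine_closure_eq (sine_closureZ 2^-1 (sine_closureB cp cn)) _ => x _.
by field.
Qed.
End EvenDensity.

(** * The convolution formula for real functions *)

Section RealTheorem.
Context {R : realType}.
Set Implicit Arguments.
Unset Strict Implicit.
Local Notation mu := (@lebesgue_measure R).
Local Notation I := (@itvI R).
Implicit Types (f g u F : R -> R).

Definition mod4_1 : pred nat := fun k => (k %% 4 == 1)%N.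

Lemma mod4_1_odd k : mod4_1 k -> odd k.
Proof. by rewrite /mod4_1 => h; lia. Qed.

Lemma sine_closure_sub (A B : pred nat) f : (forall k, A k -> B k) ->
  sine_closure A f -> sine_closure B f.
Proof.
move=> AB [Lf cf]; split=> // e e0; have [v sv fv] := cf _ e0.
exists v => //; elim: sv => [|c k w Ak _ sw]; first exact: sine_span0.
by apply: sine_spanS => //; exact: AB.
Qed.

(** The theorem for real functions, with [B(P, u) - B(C - P, u)] collected as [2 B(P, u) - B(C, u)].
    The two expansions are compared term by term. *)
Lemma cvg_sine_convolution c p u C P x : L2real c ->
  {ae mu, forall x, I x -> c (- x) = c x} -> sine_closure mod4_1 p ->
  (forall k, mod4_1 k -> ip (sineD k) p = ip (sineD k) c) ->
  (forall y, C (y + 2) = - C y) -> (forall y, I y -> C y = c y) ->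
  (forall y, P (y + 2) = - P y) -> (forall y, I y -> P y = p y) ->
  L2real u -> I x ->
  series (fun n => ip (sineD n.+1) c * ip (sineD n.+1) u * sineD n.+1 x) @ \oo -->
    2 * reflect_form P u x - reflect_form C u x.
Proof.
move=> Lc ce cp pc AC Cc AP Pp Lu Ix.
have cc : sine_closure odd c := sine_closure_even Lc ce.
have cC : sine_closure odd C by apply: sine_closure_eq cc _ => y Iy; rewrite Cc.
have cP : sine_closure odd P.
  apply: sine_closure_eq (sine_closure_sub mod4_1_odd cp) _ => y Iy; rewrite Pp//.
have eC k : ip (sineD k) C = ip (sineD k) c.
  by apply: eq_Rintegral => y; rewrite inE => Iy; rewrite Cc.
have eP k : ip (sineD k) P = ip (sineD k) p.
  by apply: eq_Rintegral => y; rewrite inE => Iy; rewrite Pp.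
have hP := cvg_form_series Ix Lu AP cP; have hC := cvg_form_series Ix Lu AC cC.
have h : (fun n => 2 * series (form_term P u x) n - series (form_term C u x) n) @ \oo -->
    2 * reflect_form P u x - reflect_form C u x.
  by apply: cvgB => //; apply: cvgM => //; exact: cvg_cst.
apply: cvg_trans h; apply: near_eq_cvg; apply: nearW => n.
rewrite /series/= mulr_sumr -sumrB; apply: eq_bigr => k _.
rewrite /form_term eP eC.
(* For even frequencies both coefficients vanish. For 1 mod 4, [sigma] is 1 and the coefficients of
   [p] and [c] agree; for 3 mod 4, [sigma] is -1 and that of [p] is zero. *)
have [ ok|ek] := boolP (odd k.+1); last first.
  by rewrite (sine_closure_coef0 _ ek cc)//
    (sine_closure_coef0 _ ek (sine_closure_sub mod4_1_odd cp))//; ring.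
have [k1|k1] := boolP (mod4_1 k.+1).
  have -> : sigma k.+1 = 1 :> R.
    rewrite sigma_half// -signr_odd; suff -> : odd k.+1./2 = false by rewrite expr0.
    by move: k1; rewrite /mod4_1 => ?; lia.
  by rewrite pc//; ring.
rewrite (sine_closure_coef0 _ k1 cp)//.
have -> : sigma k.+1 = -1 :> R.
  rewrite sigma_half// -signr_odd; suff -> : odd k.+1./2 = true by rewrite expr1.
  by move: k1; rewrite /mod4_1 => ?; lia.
by ring.
Qed.

End RealTheorem.

(** * Complex-valued functions *)

Section ComplexValued.
Context {R : realType}.
Set Implicit Arguments.
Unset Strict Implicit.
Local Notation mu := (@lebesgue_measure R).
Local Notation I := (@itvI R).
Implicit Types (f g h : R -> R[i]).
Local Notation reF f := (fun y => complex.Re (f y)).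
Local Notation imF f := (fun y => complex.Im (f y)).

Lemma L2C_real f : L2C f -> L2real (reF f) /\ L2real (imF f).
Proof.
move=> [mr mi lf].
have iS : mu.-integrable I (EFin \o (fun y => complex.Re (f y) ^+ 2 + complex.Im (f y) ^+ 2)).
  have mS : measurable_fun I (EFin \o (fun y => complex.Re (f y) ^+ 2 + complex.Im (f y) ^+ 2)).
    by apply/measurable_EFinP; apply: measurable_funD; exact: measurable_funX.
  apply/integrableP; split; first exact: mS.
  apply: le_lt_trans lf; rewrite le_eqVlt; apply/orP; left; apply/eqP.
  apply: eq_integral => y _ /=; congr EFin; rewrite ger0_norm ?addr_ge0 ?sqr_ge0//.
  by case: (f y) => a b /=; rewrite sqr_sqrtr// addr_ge0 ?sqr_ge0.
by split; apply: (L2real_le_integrable _ iS) => // y _; rewrite ?lerDl ?lerDr sqr_ge0.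
Qed.

Lemma real_L2C f : L2real (reF f) -> L2real (imF f) -> L2C f.
Proof.
move=> L1 L2; split; [by case: L1 | by case: L2 |].
have /integrableP[_] := integrableD measurable_itvI (L2real_sqr L1) (L2real_sqr L2).
apply: le_lt_trans; rewrite le_eqVlt; apply/orP; left; apply/eqP.
apply: eq_integral => y _ /=; congr EFin; rewrite ger0_norm ?addr_ge0 ?sqr_ge0//.
by case: (f y) => a b /=; rewrite sqr_sqrtr// addr_ge0 ?sqr_ge0.
Qed.

Lemma cintegralM f g : L2real (reF f) -> L2real (imF f) ->
    L2real (reF g) -> L2real (imF g) ->
  cintegral (fun y => f y * g y) =
  (ip (reF f) (reF g) - ip (imF f) (imF g)) +i*
  (ip (reF f) (imF g) + ip (imF f) (reF g)).
Proof.
move=> f1 f2 g1 g2; rewrite /cintegral; congr (_ +i* _).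
  rewrite /ip -RintegralB//; try (exact: L2real_mul); last exact: measurable_itvI.
  by apply: eq_Rintegral => y _; case: (f y) => a b; case: (g y).
rewrite /ip -RintegralD//; try (exact: L2real_mul); last exact: measurable_itvI.
by apply: eq_Rintegral => y _; case: (f y) => a b; case: (g y).
Qed.

(** The conjugation is trivial because [eD k] is real, so a complex coefficient is a pair of real
    ones. *)
Lemma inner_eD k f :
  inner (eD k) f = ip (sineD k) (reF f) +i* ip (sineD k) (imF f).
Proof.
rewrite /inner /cintegral; congr (_ +i* _); apply: eq_Rintegral => y _;
  by rewrite /eD; case: (f y) => a b /=; rewrite ?oppr0 ?mul0r ?subr0 ?addr0.
Qed.

Lemma Re_inner_self f : L2real (reF f) -> L2real (imF f) ->
  complex.Re (inner f f) = ip (reF f) (reF f) + ip (imF f) (imF f).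
Proof.
move=> f1 f2; rewrite /ip -RintegralD//; try (exact: L2real_mul); last exact: measurable_itvI.
by apply: eq_Rintegral => y _; case: (f y) => a b /=; ring.
Qed.

Local Notation S4 := [set f | exists l : nat, f = @eD R (4 * l + 1)%N].

(** The generators are real, so taking real or imaginary parts only changes the coefficients. *)
Lemma lspan_sine_span v : lspan S4 v ->
  sine_span mod4_1 (reF v) /\ sine_span mod4_1 (imF v).
Proof.
move=> [n [a [g [Sg ->]]]]; elim: n a g Sg => [|n IH] a g Sg.
  under eq_fun do rewrite big_ord0; under [X in _ /\ sine_span _ X]eq_fun do rewrite big_ord0.
  by split; exact: sine_span0.
have [h1 h2] := IH (fun i => a (lift ord0 i)) (fun i => g (lift ord0 i)) (fun i => Sg _).
have [l gl] := Sg ord0.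
have o1 : mod4_1 (4 * l + 1) by rewrite /mod4_1; lia.
split.
  have := sine_spanS (complex.Re (a ord0)) o1 h1; congr (sine_span _ _).
  apply/funext => y; rewrite big_ord_recl gl; set s := \sum_(i < n) _.
  by case: (a ord0) => a1 a2; case: s => s1 s2; rewrite /= mulr0 subr0.
have := sine_spanS (complex.Im (a ord0)) o1 h2; congr (sine_span _ _).
apply/funext => y; rewrite big_ord_recl gl; set s := \sum_(i < n) _.
by case: (a ord0) => a1 a2; case: s => s1 s2; rewrite /= mulr0 add0r.
Qed.

Lemma L2closure_sine_closure f : L2closure (lspan S4) f ->
  sine_closure mod4_1 (reF f) /\ sine_closure mod4_1 (imF f).
Proof.
move=> [/L2C_real[L1 L2] cf].
have key (e : R) : 0 < e -> exists v, [/\ sine_span mod4_1 (reF v), sine_span mod4_1 (imF v) &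
   ip (fun x => complex.Re (f x) - complex.Re (v x)) (fun x => complex.Re (f x) - complex.Re (v x)) +
   ip (fun x => complex.Im (f x) - complex.Im (v x)) (fun x => complex.Im (f x) - complex.Im (v x)) < e].
  (* [L2closure] bounds the norm and [sine_closure] its square, hence the square root. The squared
     norm is the sum of those of the real and imaginary parts, so one [v] serves both. *)
  move=> e0; have se : 0 < Num.sqrt e by rewrite sqrtr_gt0.
  have [v /lspan_sine_span[v1 v2] fv] := cf _ se; exists v; split=> //.
  have dr : reF (fun x => f x - v x) = (fun x => complex.Re (f x) - complex.Re (v x)).
    by apply/funext => x; case: (f x) (v x) => [a b] [c d].
  have di : imF (fun x => f x - v x) = (fun x => complex.Im (f x) - complex.Im (v x)).
    by apply/funext => x; case: (f x) (v x) => [a b] [c d].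
  move: fv; rewrite /L2norm ltr_sqrt// Re_inner_self ?dr ?di//.
    by apply: L2realB => //; exact: sine_span_L2real v1.
  by apply: L2realB => //; exact: sine_span_L2real v2.
split; split=> // e /key[v [v1 v2 fv]].
  exists (reF v) => //; apply: le_lt_trans fv; rewrite lerDl; exact: ip_ge0.
exists (imF v) => //; apply: le_lt_trans fv; rewrite lerDr; exact: ip_ge0.
Qed.

Lemma eD_L2closure l : L2closure (lspan S4) (eD (4 * l + 1)).
Proof.
have Ls := @L2real_sineD R (4 * l + 1); split.
  by apply: real_L2C => //; exact: L2real0.
move=> e e0; exists (eD (4 * l + 1)).
  exists 1%N, (fun=> 1), (fun=> eD (4 * l + 1)); split; first by move=> _; exists l.
  by apply/funext => x; rewrite big_ord1 mul1r.
rewrite /L2norm; suff -> : complex.Re (inner (fun x : R => eD (4 * l + 1) x - eD (4 * l + 1) x)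
   (fun x : R => eD (4 * l + 1) x - eD (4 * l + 1) x)) = 0 by rewrite sqrtr0.
under [X in inner X _]eq_fun do rewrite subrr.
rewrite /inner /cintegral/= -[RHS](ip0l (fun=> 0)).
apply: eq_Rintegral => y _; ring.
Qed.

(** Such an [eD k] belongs to the closed subspace, so it is orthogonal to [f - g]. *)
Lemma orth_proj_coef f g k : mod4_1 k -> L2C f -> orth_proj (L2closure (lspan S4)) f g ->
  inner (eD k) g = inner (eD k) f.
Proof.
move=> k4 /L2C_real[f1 f2] [[/L2C_real[g1 g2] _] H].
have ek : k = (4 * (k %/ 4) + 1)%N by move: k4; rewrite /mod4_1 => ?; lia.
have Ls := @L2real_sineD R k.
have := H _ (eD_L2closure (k %/ 4)); rewrite -ek inner_eD => -[h1 h2].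
have dr : reF (fun x => f x - g x) = (fun x => complex.Re (f x) - complex.Re (g x)).
  by apply/funext => x; case: (f x) (g x) => [a b] [c d].
have di : imF (fun x => f x - g x) = (fun x => complex.Im (f x) - complex.Im (g x)).
  by apply/funext => x; case: (f x) (g x) => [a b] [c d].
rewrite dr ipC ipBl// in h1; rewrite di ipC ipBl// in h2.
rewrite !inner_eD; congr (_ +i* _); rewrite ipC [RHS]ipC.
  by apply/eqP; rewrite eq_sym -subr_eq0 h1.
by apply/eqP; rewrite eq_sym -subr_eq0 h2.
Qed.

Lemma series_complex (z : nat -> R[i]) n :
  series z n = series (fun k => complex.Re (z k)) n +i* series (fun k => complex.Im (z k)) n.
Proof.
rewrite /series/=; elim: n => [|n IH]; first by rewrite !big_geq.
by rewrite !big_nat_recr//= IH; case: (z n).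
Qed.

Lemma cvg_complex (z : nat -> R[i]^o) (a b : R) :
  (fun n => complex.Re (z n)) @ \oo --> a -> (fun n => complex.Im (z n)) @ \oo --> b ->
  z @ \oo --> (a +i* b : R[i]^o).
Proof.
move=> ha hb; apply/cvgrPdist_lt => e.
(* In the order on the complex numbers a positive [e] has zero imaginary part, which reduces the
   estimate to a real one. *)
case: e => e1 e2; rewrite ltcE/= => /andP[/eqP -> e0].
have e2' : 0 < e1 / 2 by rewrite divr_gt0.
move/cvgrPdist_lt : ha => /(_ _ e2') ha; move/cvgrPdist_lt : hb => /(_ _ e2') hb.
near=> n.
have h1 : `|a - complex.Re (z n)| < e1 / 2 by near: n.
have h2 : `|b - complex.Im (z n)| < e1 / 2 by near: n.
move: h1 h2; case: (z n) => c d /= h1 h2.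
rewrite normc_def/= ltcE/= eqxx/=.
set p := a - c in h1 *; set q := b - d in h2 *.
rewrite -(@ger0_norm _ e1) 1?ltW// -sqrtr_sqr ltr_sqrt ?exprn_gt0//.
have : (`|p| + `|q|) ^+ 2 < e1 ^+ 2.
  rewrite ltr_sqr ?nnegrE ?addr_ge0// 1?ltW//; lra.
apply: le_lt_trans; rewrite -(real_normK (num_real p)) -(real_normK (num_real q)) sqrrD.
have := mulr_ge0 (normr_ge0 p) (normr_ge0 q); lra.
Unshelve. all: by end_near.
Qed.

End ComplexValued.

(** * Assembly of the complex formula from real and imaginary parts *)

Section Assembly.
Context {R : realType}.
Set Implicit Arguments.
Unset Strict Implicit.
Local Notation I := (@itvI R).
Local Notation reF f := (fun y => complex.Re (f y)).
Local Notation imF f := (fun y => complex.Im (f y)).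

Lemma ReB (a b : R[i]) : complex.Re (a - b) = complex.Re a - complex.Re b.
Proof. by case: a b => [? ?] [? ?]. Qed.

Lemma ImB (a b : R[i]) : complex.Im (a - b) = complex.Im a - complex.Im b.
Proof. by case: a b => [? ?] [? ?]. Qed.

Lemma cintegralBM (f g h : R -> R[i]) : L2real (reF f) -> L2real (imF f) ->
    L2real (reF g) -> L2real (imF g) -> L2real (reF h) -> L2real (imF h) ->
  cintegral (fun y => (f y - g y) * h y) =
  cintegral (fun y => f y * h y) - cintegral (fun y => g y * h y).
Proof.
move=> f1 f2 g1 g2 h1 h2.
have e1 : reF (fun y => f y - g y) = (fun y => complex.Re (f y) - complex.Re (g y)).
  by apply/funext => y; rewrite ReB.
have e2 : imF (fun y => f y - g y) = (fun y => complex.Im (f y) - complex.Im (g y)).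
  by apply/funext => y; rewrite ImB.
have L1 := L2realB f1 g1; have L2 := L2realB f2 g2.
rewrite !cintegralM ?e1 ?e2// !ipBl//.
by apply/eqP; rewrite eq_complex/=; apply/andP; split; apply/eqP; ring.
Qed.

Lemma sqrt_sqrD_le (a b : R) : Num.sqrt (a ^+ 2 + b ^+ 2) <= `|a| + `|b|.
Proof.
rewrite -[leRHS]ger0_norm ?addr_ge0// -sqrtr_sqr ler_wsqrtr//.
rewrite -(real_normK (num_real a)) -(real_normK (num_real b)) sqrrD.
by have := mulr_ge0 (normr_ge0 a) (normr_ge0 b); lra.
Qed.

End Assembly.

Theorem mainTheorem18 (R : realType) (C PC Ca PCa : R -> R[i])
    (hC : L2C C) (hCeven : even_on_I C)
    (hPC : orth_proj
             (L2closure (lspan [set f | exists l : nat, f = eD (4 * l + 1)%N]))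
             C PC)
    (hCa : antiperiodic_ext C Ca) (hPCa : antiperiodic_ext PC PCa)
    (u : R -> R[i]) (hu : L2C u) (x : R) (hx : itvI x) :
  cvgn [normed series (convD_term C u x)] /\
  convD C u x =
    1 / 2 * cintegral (fun y => PCa (x - y) * u y)
    + 1 / 2 * cintegral (fun y => PCa (- x - y) * u y)
    - 1 / 2 * cintegral (fun y => (Ca (x - y) - PCa (x - y)) * u y)
    - 1 / 2 * cintegral (fun y => (Ca (- x - y) - PCa (- x - y)) * u y).
Proof.
have [C1 C2] := L2C_real hC; have [u1 u2] := L2C_real hu.
have [p1 p2] := L2closure_sine_closure hPC.1.
have even1 : {ae lebesgue_measure, forall x : R, itvI x -> complex.Re (C (- x)) = complex.Re (C x)}.
  by apply: ae_sub hCeven => y + Iy => ->.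
have even2 : {ae lebesgue_measure, forall x : R, itvI x -> complex.Im (C (- x)) = complex.Im (C x)}.
  by apply: ae_sub hCeven => y + Iy => ->.
have coefPC k : mod4_1 k -> inner (eD k) PC = inner (eD k) C.
  by move=> k4; exact: orth_proj_coef k4 hC hPC.
have coef1 k : mod4_1 k ->
    ip (sineD k) (fun y => complex.Re (PC y)) = ip (sineD k) (fun y => complex.Re (C y)).
  by move=> /coefPC; rewrite !inner_eD => -[].
have coef2 k : mod4_1 k ->
    ip (sineD k) (fun y => complex.Im (PC y)) = ip (sineD k) (fun y => complex.Im (C y)).
  by move=> /coefPC; rewrite !inner_eD => -[].
have [aC eC] := hCa; have [aP eP] := hPCa.
have aC1 y : complex.Re (Ca (y + 2)) = - complex.Re (Ca y) by rewrite aC; case: (Ca y).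
have aC2 y : complex.Im (Ca (y + 2)) = - complex.Im (Ca y) by rewrite aC; case: (Ca y).
have aP1 y : complex.Re (PCa (y + 2)) = - complex.Re (PCa y) by rewrite aP; case: (PCa y).
have aP2 y : complex.Im (PCa (y + 2)) = - complex.Im (PCa y) by rewrite aP; case: (PCa y).
have eC1 y : itvI y -> complex.Re (Ca y) = complex.Re (C y) by move/eC->.
have eC2 y : itvI y -> complex.Im (Ca y) = complex.Im (C y) by move/eC->.
have eP1 y : itvI y -> complex.Re (PCa y) = complex.Re (PC y) by move/eP->.
have eP2 y : itvI y -> complex.Im (PCa y) = complex.Im (PC y) by move/eP->.
(* By bilinearity the complex statement reduces to four real ones, pairing each part of [C] with
   each part of [u]. *)
have K1 v (Lv : L2real v) := cvg_sine_convolution C1 even1 p1 coef1 aC1 eC1 aP1 eP1 Lv hx.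
have K2 v (Lv : L2real v) := cvg_sine_convolution C2 even2 p2 coef2 aC2 eC2 aP2 eP2 Lv hx.
have K11 := K1 _ u1; have K12 := K1 _ u2; have K21 := K2 _ u1; have K22 := K2 _ u2.
pose c1 k := ip (sineD k) (fun y => complex.Re (C y)).
pose c2 k := ip (sineD k) (fun y => complex.Im (C y)).
pose d1 k := ip (sineD k) (fun y => complex.Re (u y)).
pose d2 k := ip (sineD k) (fun y => complex.Im (u y)).
have termE n : convD_term C u x n =
   ((c1 n.+1 * d1 n.+1 * sineD n.+1 x - c2 n.+1 * d2 n.+1 * sineD n.+1 x) +i*
    (c1 n.+1 * d2 n.+1 * sineD n.+1 x + c2 n.+1 * d1 n.+1 * sineD n.+1 x)).
  rewrite /convD_term !inner_eD -/(c1 _) -/(c2 _) -/(d1 _) -/(d2 _) /eD -/(sineD n.+1 x).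
  by apply/eqP; rewrite eq_complex/=; apply/andP; split; apply/eqP; ring.
split.
  (* [r] is the modulus of the general term as a real number; it is dominated by four products of
     real coefficients, each absolutely summable. *)
  pose r n := Num.sqrt (complex.Re (convD_term C u x n) ^+ 2 + complex.Im (convD_term C u x n) ^+ 2).
  have cr : cvgn (series r).
    apply: (@series_le_cvg _ r ((fun n => `|c1 n.+1 * d1 n.+1|) + (fun n => `|c2 n.+1 * d2 n.+1|)
        + ((fun n => `|c1 n.+1 * d2 n.+1|) + (fun n => `|c2 n.+1 * d1 n.+1|)))).
    - by move=> n; exact: sqrtr_ge0.
    - by move=> n; rewrite !addr_ge0.
    - move=> n; apply: le_trans (sqrt_sqrD_le _ _) _; rewrite termE /=.
      have s1 := @sineD_le1 R n.+1 x.
      have H (a b : R) : `|a * b * sineD n.+1 x| <= `|a * b|.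
        by rewrite normrM ler_piMr.
      apply: lerD; first by apply: le_trans (ler_normB _ _) _; apply: lerD; exact: H.
      by apply: le_trans (ler_normD _ _) _; apply: lerD; exact: H.
    - by do 2 (apply: is_cvg_seriesD => //); exact: is_cvg_sum_coefM.
  (* The norm on the complex numbers is itself complex-valued with zero imaginary part, so the limit
     of the normed series is given in that form. *)
  apply: (cvgP ((limn (series r)) +i* 0 : R[i]^o)).
  have E n : [normed series (convD_term C u x)] n = series r n +i* 0.
    apply: (etrans (series_complex (fun k => `|convD_term C u x k|) n)).
    congr (_ +i* _); rewrite /series/=.
    exact: big1.
  apply: cvg_complex.
    by under eq_fun do rewrite E; exact: cr.
  by under eq_fun do rewrite E; exact: cvg_cst.
have -> : convD C u x =
  (2 * reflect_form (fun y => complex.Re (PCa y)) (fun y => complex.Re (u y)) x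
    - reflect_form (fun y => complex.Re (Ca y)) (fun y => complex.Re (u y)) x
   - (2 * reflect_form (fun y => complex.Im (PCa y)) (fun y => complex.Im (u y)) x
    - reflect_form (fun y => complex.Im (Ca y)) (fun y => complex.Im (u y)) x)) +i*
  (2 * reflect_form (fun y => complex.Re (PCa y)) (fun y => complex.Im (u y)) x
    - reflect_form (fun y => complex.Re (Ca y)) (fun y => complex.Im (u y)) x
   + (2 * reflect_form (fun y => complex.Im (PCa y)) (fun y => complex.Re (u y)) x
    - reflect_form (fun y => complex.Im (Ca y)) (fun y => complex.Re (u y)) x)).
  rewrite /convD; apply: (@cvg_lim (R[i]^o : normedModType R[i])); first exact: norm_hausdorff.
  apply: cvg_complex.
    have -> : (fun n => complex.Re (series (convD_term C u x) n)) =
        (fun n => series (fun n => c1 n.+1 * d1 n.+1 * sineD n.+1 x) n -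
                  series (fun n => c2 n.+1 * d2 n.+1 * sineD n.+1 x) n).
      apply/funext => n; rewrite series_complex -[LHS]/(\sum_(0 <= k < n) complex.Re (convD_term C u x k)).
      rewrite /series -sumrB.
      by apply: eq_bigr => k _; rewrite termE.
    exact: cvgB K11 K22.
  have -> : (fun n => complex.Im (series (convD_term C u x) n)) =
      (fun n => series (fun n => c1 n.+1 * d2 n.+1 * sineD n.+1 x) n +
                series (fun n => c2 n.+1 * d1 n.+1 * sineD n.+1 x) n).
    apply/funext => n; rewrite series_complex -[LHS]/(\sum_(0 <= k < n) complex.Im (convD_term C u x k)).
    rewrite /series -big_split.
    by apply: eq_bigr => k _; rewrite termE.
  exact: cvgD K12 K21.
have hNx := itvIN hx.
have half : 1 / 2 = (2^-1)%:C :> R[i] by rewrite mul1r fmorphV rmorph_nat.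
(* Used at [x] and at [- x]: square integrability of the reflections allows the integrals of
   [Ca - PCa] to be split and the complex products to be expanded. *)
have A z : itvI z -> [/\ L2real (fun y => complex.Re (Ca (z - y))),
   L2real (fun y => complex.Im (Ca (z - y))), L2real (fun y => complex.Re (PCa (z - y)))
   & L2real (fun y => complex.Im (PCa (z - y)))].
  move=> Iz; have [[P1 _] [P2 _]] := (p1, p2); split.
  - by apply: (proj1 (antiperiodic_reflect aC1 _ Iz)); apply: eq_L2real C1 => y /eC1.
  - by apply: (proj1 (antiperiodic_reflect aC2 _ Iz)); apply: eq_L2real C2 => y /eC2.
  - by apply: (proj1 (antiperiodic_reflect aP1 _ Iz)); apply: eq_L2real P1 => y /eP1.
  - by apply: (proj1 (antiperiodic_reflect aP2 _ Iz)); apply: eq_L2real P2 => y /eP2.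
have [a1 a2 a3 a4] := A _ hx; have [b1 b2 b3 b4] := A _ hNx.
rewrite !(cintegralBM (f := fun y => Ca (_ - y))) ?cintegralM//.
rewrite half /reflect_form; simpc.
by apply/eqP; rewrite eq_complex/=; apply/andP; split; apply/eqP; field.
Qed.
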